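(* Let $\mathbb A=\mathbb A(R,\Lambda)$ be a model space. The standard $\Lambda$-metric $$d(x,y)=\sum_{\alpha\in R^+}|\langle y-x,\alpha^\vee\rangle|,\qquad x,y\in\mathbb A,$$ where $R^+$ is the set of positive roots of $R$, is Weyl compatible.
   Context: $R$ is a (not necessarily crystallographic) spherical root system with co-roots $\alpha^\vee$; $F\subseteq\mathbb R$ is a subfield containing all $\langle\beta,\alpha^\vee\rangle$, $\alpha,\beta\in R$; $\Lambda$ is a totally ordered abelian group with an $F$-module structure (positive elements of $F$ preserve the order). Put $\mathbb A=\mathbb A(R,\Lambda)=\mathrm{span}_F(R)\otimes_F\Lambda$, with the natural action of the spherical Weyl group $\overline W$; the pairing $\langle\cdot,\alpha^\vee\rangle$ extends $\Lambda$-valued to $\mathbb A$. Fix a $\overline W$-invariant group $T$ of translations of $\mathbb A$; $W_T=\overline W\ltimes T$, and $W=\overline W\ltimes\mathbb A$ is the full affine Weyl group. An affine reflection is an element $t\circ r_\alpha\in W_T$ ($t\in T$, $r_\alpha$ a reflection of $\overline W$) with nonempty fixed point set; this set is called a hyperplane. A hyperplane separates $x,y$ if they lie in different open half-spaces determined by it. Fix a basis $B=\{\alpha_i\}$ of $R$ (defining the positive roots $R^+$). The fundamental Weyl chamber is $\mathcal C_f=\{x:\langle x,\alpha^\vee\rangle\ge 0\ \forall \alpha\in B\}$; Weyl chambers are its images under $W$; Weyl simplices (sector faces) are faces of Weyl chambers; panels are Weyl simplices of codimension one. A sub-face of a Weyl simplex is a translate of it contained in it. The panel of $\mathcal C_f$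 on which $\langle\cdot,\alpha_i^\vee\rangle=0$ has type $i$; the type of a face of $\mathcal C_f$ is the union of the types of the panels containing it; the type of a Weyl simplex is the type of the unique face of $\mathcal C_f$ of which it is a $W$-image. For a $\Lambda$-metric $d$, $\mathrm{seg}_{\mathbb A}(x,y)=\{z: d(x,y)=d(x,z)+d(z,y)\}$. A $W_T$-invariant $\Lambda$-metric $d$ on $\mathbb A$ is *Weyl compatible* if: (1) for all Weyl chambers $S$ and all Weyl simplices $P_1,P_2$ of the same type: if there is $\lambda\in\Lambda$ such that for every sub-face $P_1'\subset P_1$ there is a sub-face $P_2'\subset P_2$ such that for each $y\in P_2'$ there is $x\in P_1'$ with $|d(v,y)-d(v,x)|\le\lambda$ for all $v\in S$, then $P_1,P_2$ are translates of one another; (2) whenever a hyperplane $H$ separates $x$ and $y$, $\mathrm{seg}_{\mathbb A}(x,y)\cap H\ne\emptyset$. *)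

(* Defs.v *)
From HB Require Import structures.
From mathcomp Require Import all_boot all_order all_algebra.
From mathcomp Require Import finmap.
From mathcomp Require Import boolp classical_sets reals.

Set Implicit Arguments.
Unset Strict Implicit.
Unset Printing Implicit Defensive.

Import Order.TTheory GRing.Theory Num.Theory.
Local Open Scope ring_scope.
Local Open Scope quotient_scope.
Local Open Scope classical_set_scope.

(** ** Tensor product of two modules over a commutative ring

   Elements are formal finite sums [:: (m_1, l_1); ...] of elementary tensors,
   two sums being identified when no bilinear map distinguishes them.
   [tens_bilinear], [tlift_linear], [tlift_tens] and [tlift_unique] are the
   universal property. *)

Section Bilinear.
Variables (F : comNzRingType) (M L U : lmodType F).

Definition bilinear_map (b : M -> L -> U) : Prop :=
  (forall l, linear (b^~ l)) /\ (forall m, linear (b m)).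

Definition tsum (b : M -> L -> U) (s : seq (M * L)) : U :=
  \sum_(p <- s) b p.1 p.2.

Lemma bilinear0l b l : bilinear_map b -> b 0 l = 0.
Proof.
move=> [hl _]; have := hl l (-1) 0 0.
by rewrite scaler0 addr0 scaleN1r addNr.
Qed.

Lemma bilinear0r b m : bilinear_map b -> b m 0 = 0.
Proof.
move=> [_ hr]; have := hr m (-1) 0 0.
by rewrite scaler0 addr0 scaleN1r addNr.
Qed.

Lemma bilinearZl b a m l : bilinear_map b -> b (a *: m) l = a *: b m l.
Proof.
by move=> hb; rewrite -[a *: m]addr0 (hb.1 l) bilinear0l ?addr0.
Qed.

Lemma tsum_cat b s t : tsum b (s ++ t) = tsum b s + tsum b t.
Proof. exact: big_cat. Qed.

Lemma tsum_scale b a s : bilinear_map b ->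
  tsum b [seq (a *: p.1, p.2) | p <- s] = a *: tsum b s.
Proof.
move=> hb; rewrite /tsum big_map scaler_sumr.
by apply: eq_bigr => p _; rewrite /= bilinearZl.
Qed.
End Bilinear.

Section Tensor.
Variables (F : comNzRingType) (M L : lmodType F).

Definition tensor_eq (s t : seq (M * L)) : bool :=
  `[< forall (U : lmodType F) (b : M -> L -> U),
        bilinear_map b -> tsum b s = tsum b t >].

Lemma tensor_eq_refl : reflexive tensor_eq.
Proof. by move=> s; apply/asboolP. Qed.

Lemma tensor_eq_sym : symmetric tensor_eq.
Proof.
by move=> s t; apply/asboolP/asboolP => h U b hb; rewrite h.
Qed.

Lemma tensor_eq_trans : transitive tensor_eq.
Proof.
by move=> t s r /asboolP h1 /asboolP h2; apply/asboolP => U b hb; rewrite h1 ?h2.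
Qed.

Canonical tensor_equiv :=
  EquivRel tensor_eq tensor_eq_refl tensor_eq_sym tensor_eq_trans.

Definition tensor := {eq_quot tensor_equiv}.

HB.instance Definition _ := Choice.on tensor.
HB.instance Definition _ := EqQuotient.on tensor.

Definition tens (m : M) (l : L) : tensor := \pi_tensor [:: (m, l)].

(* the linear map induced by b, meaningful when b is bilinear *)
Definition tlift (U : lmodType F) (b : M -> L -> U) (x : tensor) : U :=
  tsum b (repr x).

Lemma tlift_pi (U : lmodType F) (b : M -> L -> U) s : bilinear_map b ->
  tlift b (\pi_tensor s) = tsum b s.
Proof.
move=> hb; suff /asboolP h : tensor_eq (repr (\pi_tensor s)) s by exact: h.
by rewrite -[tensor_eq _ _](@pi_eq_quot _ tensor_equiv tensor) reprK.
Qed.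

Lemma tensorP (x y : tensor) :
  (forall (U : lmodType F) (b : M -> L -> U),
     bilinear_map b -> tlift b x = tlift b y) -> x = y.
Proof.
move=> h; rewrite -[x]reprK -[y]reprK; apply/eqP.
by rewrite (@pi_eq_quot _ tensor_equiv tensor); apply/asboolP.
Qed.

Definition tensor_zero : tensor := \pi_tensor [::].
Definition tensor_add (x y : tensor) : tensor :=
  \pi_tensor (repr x ++ repr y).
Definition tensor_scale (a : F) (x : tensor) : tensor :=
  \pi_tensor [seq (a *: p.1, p.2) | p <- repr x].
Definition tensor_opp (x : tensor) : tensor := tensor_scale (-1) x.

Section Lift.
Variables (U : lmodType F) (b : M -> L -> U).
Hypothesis hb : bilinear_map b.

Lemma tlift0 : tlift b tensor_zero = 0.
Proof. by rewrite tlift_pi // /tsum big_nil. Qed.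

Lemma tliftD x y : tlift b (tensor_add x y) = tlift b x + tlift b y.
Proof. by rewrite tlift_pi // tsum_cat. Qed.

Lemma tliftZ a x : tlift b (tensor_scale a x) = a *: tlift b x.
Proof. by rewrite tlift_pi // tsum_scale. Qed.

Lemma tliftN x : tlift b (tensor_opp x) = - tlift b x.
Proof. by rewrite tliftZ scaleN1r. Qed.
End Lift.

Lemma tensor_addA : associative tensor_add.
Proof. by move=> x y z; apply: tensorP => U b hb; rewrite !tliftD ?addrA. Qed.

Lemma tensor_addC : commutative tensor_add.
Proof. by move=> x y; apply: tensorP => U b hb; rewrite !tliftD // addrC. Qed.

Lemma tensor_add0 : left_id tensor_zero tensor_add.
Proof. by move=> x; apply: tensorP => U b hb; rewrite tliftD // tlift0 ?add0r. Qed.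

Lemma tensor_addN : left_inverse tensor_zero tensor_opp tensor_add.
Proof.
by move=> x; apply: tensorP => U b hb; rewrite tliftD // tliftN // tlift0 // addNr.
Qed.

HB.instance Definition _ := GRing.isZmodule.Build tensor
  tensor_addA tensor_addC tensor_add0 tensor_addN.

Lemma tensor_scaleA a c (x : tensor) :
  tensor_scale a (tensor_scale c x) = tensor_scale (a * c) x.
Proof. by apply: tensorP => U b hb; rewrite !tliftZ // scalerA. Qed.

Lemma tensor_scale1 : left_id 1 tensor_scale.
Proof. by move=> x; apply: tensorP => U b hb; rewrite tliftZ // scale1r. Qed.

Lemma tensor_scaleDr : right_distributive tensor_scale +%R.
Proof.
move=> a x y; apply: tensorP => U b hb.
by rewrite tliftZ // !tliftD // !tliftZ // scalerDr.
Qed.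

Lemma tensor_scaleDl (x : tensor) : {morph tensor_scale^~ x : a c / a + c}.
Proof.
move=> a c; apply: tensorP => U b hb.
by rewrite tliftZ // tliftD // !tliftZ // scalerDl.
Qed.

HB.instance Definition _ := GRing.Zmodule_isLmodule.Build F tensor
  tensor_scaleA tensor_scale1 tensor_scaleDr tensor_scaleDl.

Lemma tlift_linear (U : lmodType F) (b : M -> L -> U) :
  bilinear_map b -> linear (tlift b).
Proof. by move=> hb a x y; rewrite (tliftD hb) (tliftZ hb). Qed.

Lemma tlift_tens (U : lmodType F) (b : M -> L -> U) m l :
  bilinear_map b -> tlift b (tens m l) = b m l.
Proof. by move=> hb; rewrite tlift_pi // /tsum big_seq1. Qed.

Lemma tens_bilinear : bilinear_map tens.
Proof.
split=> [l a m m'|m a l l']; apply: tensorP => U b hb;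
  rewrite (tliftD hb) (tliftZ hb) !tlift_tens //.
- exact: hb.1.
- exact: hb.2.
Qed.

Lemma tens_gen (x : tensor) : x = \sum_(p <- repr x) tens p.1 p.2.
Proof.
apply: tensorP => U b hb; rewrite {1}/tlift /tsum.
elim: (repr x) => [|p s ih]; first by rewrite !big_nil tlift0.
by rewrite !big_cons tliftD // ih tlift_tens.
Qed.

Lemma tlift_unique (U : lmodType F) (b : M -> L -> U) (g : {linear tensor -> U}) :
  bilinear_map b -> (forall m l, g (tens m l) = b m l) -> g =1 tlift b.
Proof.
move=> hb h x; rewrite {1}(tens_gen x) raddf_sum.
by apply: eq_bigr => p _; exact: h.
Qed.
End Tensor.

(** ** Totally ordered modules over a subfield of the reals *)

HB.mixin Record isOrderedModule (K : realType) (P : pred K)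
    (F : subFieldType P) L of GRing.Lmodule F L & Num.POrderedZmodule L := {
  ordmod_total : forall x y : L, (x <= y) || (y <= x);
  ordmod_addl : forall z x y : L, x <= y -> z + x <= z + y;
  ordmod_scale : forall (c : F) (x y : L),
    0 < (\val c : K) -> x <= y -> c *: x <= c *: y
}.

#[short(type="ordLmodType")]
HB.structure Definition OrderedModule (K : realType) (P : pred K)
    (F : subFieldType P) :=
  { L of isOrderedModule K P F L & GRing.Lmodule F L & Num.POrderedZmodule L }.

(** ** Root systems *)

Section RootSystem.
Variables (K : realType) (n : nat).
Implicit Types (u v : 'rV[K]_n) (R : {fset 'rV[K]_n}).

Definition dotp u v : K := (u *m v^T) 0 0.

(* <v, a^vee> *)
Definition coroot (a v : 'rV[K]_n) : K := 2 * dotp v a / dotp a a.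

Definition reflV (a v : 'rV[K]_n) : 'rV[K]_n := v - coroot a v *: a.

(* Neither reducedness nor integrality is required. *)
Definition root_system R : Prop :=
  0 \notin R /\ {in R &, forall a b, reflV a b \in R}.

Definition root_basis R (B : {set R}) : Prop :=
  free [seq \val b | b in B] /\
  forall a : R, exists c : R -> K,
    \val a = \sum_(b in B) c b *: \val b /\
    ((forall b, b \in B -> 0 <= c b) \/ (forall b, b \in B -> c b <= 0)).

Definition pos_root R (B : {set R}) (a : R) : bool :=
  `[< exists c : R -> K, \val a = \sum_(b in B) c b *: \val b /\
        forall b, b \in B -> 0 <= c b >].

(* all <b, a^vee> lie in the subfield P *)
Definition coroots_in (P : pred K) R : Prop :=
  {in R &, forall a b, P (coroot a b)}.
End RootSystem.

(** ** The F-span of a root system *)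

Section FSpan.
Variables (K : realType) (P : pred K) (F : subFieldType P) (n : nat).
Variable R : {fset 'rV[K]_n}.

Definition in_Fspan : pred 'rV[K]_n := fun v =>
  `[< exists c : R -> F, v = \sum_(a : R) (\val (c a) : K) *: \val a >].

Record Fspan := FSpan { Fspan_val : 'rV[K]_n; _ : in_Fspan Fspan_val }.

HB.instance Definition _ := [isSub for Fspan_val].
HB.instance Definition _ := [Choice of Fspan by <:].

Fact in_Fspan_zmod : zmod_closed in_Fspan.
Proof.
split.
  apply/asboolP; exists (fun=> 0).
  by rewrite big1 // => a _; rewrite raddf0 scale0r.
move=> u v /asboolP[c ->] /asboolP[c' ->]; apply/asboolP.
exists (fun a => c a - c' a); rewrite -sumrB.
by apply: eq_bigr => a _; rewrite raddfB scalerBl.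
Qed.

HB.instance Definition _ := GRing.isZmodClosed.Build _ in_Fspan in_Fspan_zmod.
HB.instance Definition _ := [SubChoice_isSubZmodule of Fspan by <:].

Fact in_Fspan_scale (c : F) v : in_Fspan v -> in_Fspan ((\val c : K) *: v).
Proof.
move=> /asboolP[d ->]; apply/asboolP; exists (fun a => c * d a).
by rewrite scaler_sumr; apply: eq_bigr => a _; rewrite scalerA rmorphM.
Qed.

Definition Fspan_scale (c : F) (v : Fspan) : Fspan :=
  FSpan (in_Fspan_scale c (valP v)).

Fact Fspan_scaleA a b v : Fspan_scale a (Fspan_scale b v) = Fspan_scale (a * b) v.
Proof. by apply: val_inj; rewrite /= scalerA rmorphM. Qed.

Fact Fspan_scale1 : left_id 1 Fspan_scale.
Proof. by move=> v; apply: val_inj; rewrite /= rmorph1 scale1r. Qed.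

Fact Fspan_scaleDr : right_distributive Fspan_scale +%R.
Proof. by move=> a u v; apply: val_inj; rewrite /= scalerDr. Qed.

Fact Fspan_scaleDl v : {morph Fspan_scale^~ v : a b / a + b}.
Proof. by move=> a b; apply: val_inj; rewrite /= raddfD scalerDl. Qed.

HB.instance Definition _ := GRing.Zmodule_isLmodule.Build F Fspan
  Fspan_scaleA Fspan_scale1 Fspan_scaleDr Fspan_scaleDl.

Fact root_in_Fspan (a : R) : in_Fspan (\val a).
Proof.
apply/asboolP; exists (fun b => (b == a)%:R).
rewrite (bigD1 a) //= eqxx rmorph1 scale1r big1 ?addr0 // => b /negbTE ->.
by rewrite raddf0 scale0r.
Qed.

Definition root_span (a : R) : Fspan := FSpan (root_in_Fspan a).

(* The default value 0 of insubd is never used when coroots_in P R holds. *)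
Definition corootF (a : R) (v : Fspan) : F :=
  insubd (0 : F) (coroot (\val a) (\val v)).

Definition reflF (a : R) (v : Fspan) : Fspan := v - corootF a v *: root_span a.
End FSpan.

(** ** The model space *)

Section ModelSpace.
Variables (K : realType) (P : pred K) (F : subFieldType P) (n : nat).
Variables (R : {fset 'rV[K]_n}) (L : ordLmodType F).

Definition model_space : lmodType F := tensor (Fspan F R) L.
Local Notation A := model_space.

(* <x, a^vee> in L, the extension of <v, a^vee> *)
Definition pairing (x : A) (a : R) : L := tlift (fun v l => corootF a v *: l) x.

Definition refl (a : R) (x : A) : A := tlift (fun v l => tens (reflF a v) l) x.

(* the action on A of the spherical Weyl group *)
Inductive sph_weyl : (A -> A) -> Prop :=
| sph_weyl_id : sph_weyl id
| sph_weyl_refl (a : R) (w : A -> A) : sph_weyl w -> sph_weyl (refl a \o w).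

(* the semidirect product of the spherical Weyl group and T *)
Definition affine_weyl (T : set A) (g : A -> A) : Prop :=
  exists w t, [/\ sph_weyl w, T t & forall x, g x = w x + t].

Definition translation_group (T : set A) : Prop :=
  [/\ T 0, forall s t, T s -> T t -> T (s - t) &
      forall w t, sph_weyl w -> T t -> T (w t)].

(* H is the fixed point set of an affine reflection of W_T along a *)
Definition hyperplane (T : set A) (a : R) (H : set A) : Prop :=
  H !=set0 /\ exists2 t, T t & H = [set x | refl a x + t = x].

Definition pos_half_space (a : R) (H : set A) : set A :=
  [set x | exists2 h, H h & pairing h a < pairing x a].
Definition neg_half_space (a : R) (H : set A) : set A :=
  [set x | exists2 h, H h & pairing x a < pairing h a].

Definition separates (a : R) (H : set A) (x y : A) : Prop :=
  (pos_half_space a H x /\ neg_half_space a H y) \/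
  (neg_half_space a H x /\ pos_half_space a H y).

Section Chambers.
Variable B : {set R}.

Definition fund_chamber : set A :=
  [set x | forall b, b \in B -> 0 <= pairing x b].

Definition fund_face (I : {set R}) : set A :=
  [set x | fund_chamber x /\ forall b, b \in I -> pairing x b = 0].

Definition fund_panel (b : R) : set A := fund_face (finset.set1 b).

Definition is_fund_face (Q : set A) : Prop :=
  exists2 I : {set R}, I \subset B & Q = fund_face I.

Definition face_type (Q : set A) : {set R} :=
  finset (fun b => (b \in B) && `[< Q `<=` fund_panel b >]).

(* the full affine Weyl group is [affine_weyl setT] *)
Definition weyl_chamber (S : set A) : Prop :=
  exists2 g, affine_weyl setT g & S = g @` fund_chamber.

Definition weyl_simplex_of_type (J : {set R}) (X : set A) : Prop :=
  exists Q g, [/\ is_fund_face Q, affine_weyl setT g, X = g @` Q & J = face_type Q].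

Definition translate (X Y : set A) : Prop :=
  exists a : A, Y = [set x + a | x in X].

Definition sub_face (X' X : set A) : Prop := translate X X' /\ X' `<=` X.

Definition labs (l : L) : L := Order.max l (- l).

Definition is_metric (d : A -> A -> L) : Prop :=
  [/\ forall x y, 0 <= d x y, forall x y, d x y = 0 <-> x = y,
      forall x y, d x y = d y x & forall x y z, d x z <= d x y + d y z].

Definition segment (d : A -> A -> L) (x y : A) : set A :=
  [set z | d x y = d x z + d z y].

Definition coarsely_covered (d : A -> A -> L) (S X1 X2 : set A) (lam : L) : Prop :=
  forall X1', sub_face X1' X1 -> exists2 X2', sub_face X2' X2 &
    forall y, X2' y -> exists2 x, X1' x &
      forall v, S v -> labs (d v y - d v x) <= lam.

Definition weyl_compatible (T : set A) (d : A -> A -> L) : Prop :=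
  [/\ is_metric d,
      (forall g, affine_weyl T g -> forall x y, d (g x) (g y) = d x y),
      (forall (S X1 X2 : set A) (J : {set R}), weyl_chamber S ->
         weyl_simplex_of_type J X1 -> weyl_simplex_of_type J X2 ->
         (exists lam : L, coarsely_covered d S X1 X2 lam) -> translate X1 X2) &
      (forall (a : R) (H : set A) (x y : A), hyperplane T a H ->
         separates a H x y -> segment d x y `&` H !=set0)].

Definition standard_metric (x y : A) : L :=
  \sum_(a : R | pos_root B a) labs (pairing (y - x) a).
End Chambers.
End ModelSpace.

(* Main.v *)
(* The coroots of the basis [B] are coordinates on the model space: the Cartan
   matrix is invertible over [F], so [x |-> (<x, b^vee>)_(b in B)] identifies
   it with [L^B], and positive coroots are nonnegative combinations of the
   simple ones.

   Segments.  Moving [y - x] into the dominant chamber, a point of the segment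
   from [x] to [y] on a hyperplane separating them amounts to coordinates
   [0 <= u_b <= v_b] with a prescribed value of [sum_b k_b u_b], [k_b >= 0].
   As [L] is only an [F]-module, scaling [v] does not reach every value, but
   filling the coordinates one after the other does.

   Simplices.  [v |-> d v x] has a kink along [<v, a^vee> = <x, a^vee>], and
   this hyperplane meets the chamber of [v] when [a] is positive and
   [<x, a^vee>] is positive.  Second differences at points of the hyperplane
   that are far from all other kinks show that two points with uniformly close
   distances to the chamber have, for every positive root, either close large
   values or no large value.  Hence, if a translate of [w1 C_I] coarsely covers
   one of [w2 C_I], the same positive roots are positive on [w1 C_I] and on
   [w2 C_I]; a point of a Weyl group orbit is determined by the set of positive
   roots that are positive on it, so [w1] and [w2] agree on [C_I]. *)
Require Import Defs.
From mathcomp Require Import all_boot all_order all_algebra.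
From mathcomp Require Import finmap boolp classical_sets reals ring lra.

Set Implicit Arguments.
Unset Strict Implicit.
Unset Printing Implicit Defensive.

Import Order.TTheory GRing.Theory Num.Theory.
Local Open Scope ring_scope.
Local Open Scope classical_set_scope.

(** * Totally ordered modules *)

Section OrderedModuleTheory.
Variables (K : realType) (P : pred K) (F : subFieldType P) (L : ordLmodType F).
Implicit Types (x y z : L) (c : F).

Lemma ordmod_leD2l z x y : (z + x <= z + y) = (x <= y).
Proof.
apply/idP/idP => [h|]; last exact: ordmod_addl.
by have := ordmod_addl (- z) _ _ h; rewrite !addKr.
Qed.

Lemma ordmod_leD2r z x y : (x + z <= y + z) = (x <= y).
Proof. by rewrite ![_ + z]addrC ordmod_leD2l. Qed.

Lemma ordmod_ltD2l z x y : (z + x < z + y) = (x < y).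
Proof. by rewrite !lt_neqAle ordmod_leD2l (inj_eq (addrI z)). Qed.

Lemma ordmod_ltD2r z x y : (x + z < y + z) = (x < y).
Proof. by rewrite ![_ + z]addrC ordmod_ltD2l. Qed.

Lemma ordmod_leNgt x y : (x <= y) = ~~ (y < x).
Proof.
apply/idP/idP => [h|]; first by rewrite le_gtF.
rewrite lt_neqAle; case: eqVneq => [->|_] /=; first by rewrite lexx.
by case/orP: (ordmod_total x y) => [->|->].
Qed.

Lemma ordmod_ltNge x y : (x < y) = ~~ (y <= x).
Proof. by rewrite ordmod_leNgt negbK. Qed.

Lemma ordmod_leD x y x' y' : x <= y -> x' <= y' -> x + x' <= y + y'.
Proof.
by move=> h h'; apply: (@le_trans _ _ (y + x')); rewrite ?ordmod_leD2r ?ordmod_leD2l.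
Qed.

Lemma ordmod_ler_ltD x y x' y' : x <= y -> x' < y' -> x + x' < y + y'.
Proof.
by move=> h h'; apply: (@le_lt_trans _ _ (y + x')); rewrite ?ordmod_leD2r ?ordmod_ltD2l.
Qed.

Lemma ordmod_leN2 x y : (- x <= - y) = (y <= x).
Proof. by rewrite -(ordmod_leD2r (x + y) (- x)) [in X in _ <= X]addrC addKr addrK. Qed.

Lemma ordmod_ltN2 x y : (- x < - y) = (y < x).
Proof. by rewrite !ordmod_ltNge ordmod_leN2. Qed.

Lemma ordmod_subr_ge0 x y : (0 <= y - x) = (x <= y).
Proof. by rewrite -(ordmod_leD2r x 0) add0r subrK. Qed.

Lemma ordmod_subr_gt0 x y : (0 < y - x) = (x < y).
Proof. by rewrite -(ordmod_ltD2r x 0) add0r subrK. Qed.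

Lemma ordmod_oppr_ge0 x : (0 <= - x) = (x <= 0).
Proof. by rewrite -[in RHS]ordmod_leN2 oppr0. Qed.

Lemma ordmod_oppr_le0 x : (- x <= 0) = (0 <= x).
Proof. by rewrite -[in RHS]ordmod_leN2 oppr0. Qed.

Lemma ordmod_oppr_gt0 x : (0 < - x) = (x < 0).
Proof. by rewrite -[in RHS]ordmod_ltN2 oppr0. Qed.

Lemma ordmod_oppr_lt0 x : (- x < 0) = (0 < x).
Proof. by rewrite -[in RHS]ordmod_ltN2 oppr0. Qed.

Lemma ordmod_leBlDr x y z : (x - y <= z) = (x <= z + y).
Proof. by rewrite -(ordmod_leD2r y (x - y)) subrK. Qed.

Lemma ordmod_ltBlDr x y z : (x - y < z) = (x < z + y).
Proof. by rewrite -(ordmod_ltD2r y (x - y)) subrK. Qed.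

Lemma ordmod_leBrDr x y z : (x <= y - z) = (x + z <= y).
Proof. by rewrite -(ordmod_leD2r z x) subrK. Qed.

Lemma ordmod_addr_ge0 x y : 0 <= x -> 0 <= y -> 0 <= x + y.
Proof. by move=> hx hy; rewrite -(addr0 0) ordmod_leD. Qed.

Lemma ordmod_sumr_ge0 (I : Type) (r : seq I) (Q : pred I) (f : I -> L) :
  (forall i, Q i -> 0 <= f i) -> 0 <= \sum_(i <- r | Q i) f i.
Proof. by move=> h; elim/big_ind: _ => //; exact: ordmod_addr_ge0. Qed.

Lemma ordmod_ler_sum (I : Type) (r : seq I) (Q : pred I) (f g : I -> L) :
  (forall i, Q i -> f i <= g i) ->
  \sum_(i <- r | Q i) f i <= \sum_(i <- r | Q i) g i.
Proof. by move=> h; elim/big_ind2: _ => // *; exact: ordmod_leD. Qed.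

Lemma ordmod_psumr_eq0 (I : finType) (Q : pred I) (f : I -> L) :
  (forall i, Q i -> 0 <= f i) -> \sum_(i | Q i) f i = 0 ->
  forall i, Q i -> f i = 0.
Proof.
move=> h s i hi; apply/le_anti; rewrite h // andbT -s (bigD1 i) //=.
rewrite -[leLHS]addr0 ordmod_leD2l; apply: ordmod_sumr_ge0 => j /andP[hj _].
exact: h.
Qed.

Lemma ordmod_scale_lt c x y : 0 < (\val c : K) -> (c *: x < c *: y) = (x < y).
Proof.
move=> hc; have c0 : c != 0 by apply: contraTneq hc => ->; rewrite rmorph0 ltxx.
rewrite !lt_neqAle (inj_eq (scalerI c0)); congr (_ && _).
apply/idP/idP; last exact: ordmod_scale.
move=> /(ordmod_scale c^-1); rewrite !scalerA !mulVf // !scale1r; apply.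
by rewrite fmorphV invr_gt0.
Qed.

Lemma ordmod_scale_le c x y : 0 < (\val c : K) -> (c *: x <= c *: y) = (x <= y).
Proof. by move=> hc; rewrite !ordmod_leNgt ordmod_scale_lt. Qed.

Lemma ordmod_scale_ge0 c x : 0 <= (\val c : K) -> 0 <= x -> 0 <= c *: x.
Proof.
rewrite le_eqVlt => /orP[/eqP|hc hx]; last by rewrite -(scaler0 _ c) ordmod_scale.
by rewrite -[LHS](rmorph0 (\val : F -> K)) => /val_inj <-; rewrite scale0r.
Qed.

Lemma ordmod_scale_gt0 c x : 0 < (\val c : K) -> (0 < c *: x) = (0 < x).
Proof. by move=> hc; have := ordmod_scale_lt 0 x hc; rewrite scaler0. Qed.

Lemma ordmod_scale_mono c c' x :
  (\val c : K) <= \val c' -> 0 <= x -> c *: x <= c' *: x.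
Proof.
move=> hc hx; rewrite -ordmod_subr_ge0 -scalerBl ordmod_scale_ge0 //.
by rewrite raddfB subr_ge0.
Qed.

(** [F] carries no order of its own: signs are read in [K], while this absolute value stays in [F]
    and can act on [L]. *)
Definition fabs c : F := if 0 <= (\val c : K) then c else - c.

Lemma val_fabs c : (\val (fabs c) : K) = `|\val c|.
Proof.
rewrite /fabs; case: ifPn => [h|]; first by rewrite ger0_norm.
by rewrite -ltNge => h; rewrite raddfN ltr0_norm.
Qed.

Lemma labs_ge x : x <= labs x.
Proof. by rewrite /labs /Order.max; case: ifP => // /ltW. Qed.

Lemma labsN x : labs (- x) = labs x.
Proof.
rewrite /labs /Order.max opprK.
have [h|h] := boolP (x < - x); first by rewrite lt_gtF.
case: ifPn => // h'; apply/le_anti.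
by rewrite !ordmod_leNgt h h'.
Qed.

Lemma labs_geN x : - x <= labs x.
Proof. by rewrite -labsN labs_ge. Qed.

Lemma labsE x : labs x = x \/ labs x = - x.
Proof. by rewrite /labs /Order.max; case: ifP; [right|left]. Qed.

Lemma labs_le x y : (labs x <= y) = (x <= y) && (- x <= y).
Proof.
apply/idP/andP => [h|[]]; first by split; apply: le_trans h; rewrite ?labs_ge ?labs_geN.
by move=> h1 h2; case: (labsE x) => ->.
Qed.

Lemma labs_id x : 0 <= x -> labs x = x.
Proof.
move=> h; apply/le_anti; rewrite labs_ge labs_le lexx andbT /=.
by apply: le_trans (h); rewrite ordmod_oppr_le0.
Qed.

Lemma labs_ge0 x : 0 <= labs x.
Proof.
have [h|h] := boolP (0 <= x); first exact: le_trans (labs_ge x).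
by apply: le_trans (labs_geN x); rewrite ordmod_oppr_ge0 ltW // ordmod_ltNge.
Qed.

Lemma labs0 : labs (0 : L) = 0.
Proof. exact: labs_id. Qed.

Lemma labs_eq0 x : labs x = 0 -> x = 0.
Proof. by case: (labsE x) => -> // /eqP; rewrite oppr_eq0 => /eqP. Qed.

Lemma labsD x y : labs (x + y) <= labs x + labs y.
Proof. by rewrite labs_le ordmod_leD ?labs_ge //= opprD ordmod_leD ?labs_geN. Qed.

Lemma labsB x y : labs (x - y) = labs (y - x).
Proof. by rewrite -labsN opprB. Qed.

Lemma labsZ c x : labs (c *: x) = fabs c *: labs x.
Proof.
wlog hc : c / 0 <= (\val c : K).
  move=> w; have [/w //|] := boolP (0 <= (\val c : K)) .
  rewrite -ltNge => h; rewrite -labsN -scaleNr w ?raddfN ?oppr_ge0 ?ltW //.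
  congr (_ *: _); apply: val_inj.
  by rewrite !val_fabs raddfN normrN.
rewrite /fabs hc; have [h|] := boolP (0 <= x).
  by rewrite !labs_id // ordmod_scale_ge0.
rewrite -ordmod_ltNge => /ltW h; rewrite -labsN -scalerN -[labs x]labsN.
by rewrite !labs_id ?ordmod_scale_ge0 ?ordmod_oppr_ge0.
Qed.

Lemma labs_between x y : 0 <= x -> x <= y -> labs y = labs x + labs (y - x).
Proof.
move=> hx hy; rewrite !labs_id ?ordmod_subr_ge0 //; first by rewrite addrC subrK.
exact: le_trans hy.
Qed.

Lemma mulr2n_inj x y : x *+ 2 = y *+ 2 -> x = y.
Proof.
move=> /eqP; rewrite -!scaler_nat => /eqP /scalerI; apply.
apply/eqP => /(congr1 (\val : F -> K)) /eqP.
by rewrite rmorph_nat rmorph0 pnatr_eq0.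
Qed.

(** Triangle inequality for [2x = (x + y) + (x - y)]: second differences of [labs] are
    nonnegative. *)
Lemma labs_convex x y : labs x *+ 2 <= labs (x + y) + labs (x - y).
Proof.
rewrite -[labs x *+ 2]labs_id; last by rewrite mulr2n ordmod_addr_ge0 ?labs_ge0.
have -> : labs (labs x *+ 2) = labs ((x + y) + (x - y)).
  by rewrite addrACA subrr addr0; case: (labsE x) => ->; rewrite ?mulNrn ?labsN mulr2n.
exact: labsD.
Qed.

(** Neither [x + y] nor [x - y] has the sign opposite to [x], so [labs] is affine on this range. *)
Lemma labs_flat x y : labs y <= labs x ->
  labs (x + y) + labs (x - y) = labs x *+ 2.
Proof.
wlog hx : x y / 0 <= x => [w|].
  have [/w h /h //|] := boolP (0 <= x).
  rewrite -ordmod_ltNge => /ltW hx h.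
  have := w (- x) (- y); rewrite ordmod_oppr_ge0 !labsN => /(_ hx h) <-.
  by rewrite -!opprD !labsN.
rewrite (labs_id hx) labs_le => /andP[h1 h2].
rewrite !labs_id ?ordmod_subr_ge0 //; first by rewrite addrACA subrr addr0 mulr2n.
by rewrite -[y]opprK ordmod_subr_ge0.
Qed.

Lemma ordmod_fin_max (I : finType) (f : I -> L) :
  exists M, 0 <= M /\ forall i, f i <= M.
Proof.
(* The sum of the absolute values is a nonnegative bound even when [I] is empty. *)
exists (\sum_i labs (f i)); split; first by apply: ordmod_sumr_ge0 => i _; exact: labs_ge0.
move=> i; apply: le_trans (labs_ge _) _; rewrite (bigD1 i) //= -{1}[labs _]addr0.
by rewrite ordmod_leD2l; apply: ordmod_sumr_ge0 => j _; exact: labs_ge0.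
Qed.

End OrderedModuleTheory.

(** * Roots and the dual basis *)

Section EuclideanReflections.
Variables (K : realType) (n : nat).
Implicit Types (a b u v : 'rV[K]_n) (c : K).

Lemma dotpE u v : dotp u v = \sum_i u 0 i * v 0 i.
Proof. by rewrite /dotp mxE; apply: eq_bigr => i _; rewrite mxE. Qed.

Lemma dotpC u v : dotp u v = dotp v u.
Proof. by rewrite !dotpE; apply: eq_bigr => i _; rewrite mulrC. Qed.

Lemma dotpDl u v b : dotp (u + v) b = dotp u b + dotp v b.
Proof. by rewrite /dotp mulmxDl mxE. Qed.

Lemma dotpZl c u v : dotp (c *: u) v = c * dotp u v.
Proof. by rewrite /dotp -scalemxAl mxE. Qed.

Lemma dotpBl u v b : dotp (u - v) b = dotp u b - dotp v b.
Proof. by rewrite -scaleN1r dotpDl dotpZl mulN1r. Qed.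

Lemma dotpZr c u v : dotp u (c *: v) = c * dotp u v.
Proof. by rewrite dotpC dotpZl dotpC. Qed.

Lemma dotpBr u v b : dotp b (u - v) = dotp b u - dotp b v.
Proof. by rewrite dotpC dotpBl ![dotp b _]dotpC. Qed.

Lemma dotp_suml (I : finType) (Q : pred I) (f : I -> 'rV[K]_n) v :
  dotp (\sum_(i | Q i) f i) v = \sum_(i | Q i) dotp (f i) v.
Proof. by rewrite /dotp mulmx_suml summxE. Qed.

Lemma dotp_gt0 v : (0 < dotp v v) = (v != 0).
Proof.
have h0 : 0 <= dotp v v by rewrite dotpE; apply: sumr_ge0 => i _; rewrite -expr2 sqr_ge0.
rewrite lt_neqAle h0 andbT eq_sym; congr (~~ _); apply/eqP/eqP => [|->]; last first.
  by rewrite /dotp mul0mx mxE.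
rewrite dotpE => /psumr_eq0P h; apply/rowP => i; rewrite mxE.
have /eqP := h (fun j _ => sqr_ge0 (v 0 j)) i isT.
by rewrite -expr2 sqrf_eq0 => /eqP.
Qed.

Lemma dotp_neq0 v : v != 0 -> dotp v v != 0.
Proof. by rewrite -dotp_gt0 => /lt0r_neq0. Qed.

Lemma corootD a u v : coroot a (u + v) = coroot a u + coroot a v.
Proof. by rewrite /coroot dotpDl mulrDr mulrDl. Qed.

Lemma corootZ a c v : coroot a (c *: v) = c * coroot a v.
Proof. by rewrite /coroot dotpZl !mulrA [2 * c]mulrC. Qed.

Lemma coroot_sum (I : finType) (Q : pred I) a (f : I -> 'rV[K]_n) :
  coroot a (\sum_(i | Q i) f i) = \sum_(i | Q i) coroot a (f i).
Proof. by rewrite /coroot dotp_suml mulr_sumr mulr_suml. Qed.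

Lemma coroot_diag a : a != 0 -> coroot a a = 2.
Proof. by move=> /dotp_neq0 a0; rewrite /coroot mulfK. Qed.

Lemma reflV_diag a : a != 0 -> reflV a a = - a.
Proof. by move=> a0; rewrite /reflV coroot_diag // scaler_nat mulr2n opprD addNKr. Qed.

Lemma dotp_reflV a u v : a != 0 -> dotp (reflV a u) v = dotp u (reflV a v).
Proof.
move=> /dotp_neq0 a0; rewrite /reflV /coroot dotpBl dotpZl dotpBr dotpZr.
by rewrite [dotp a v]dotpC; field.
Qed.

Lemma reflVK a : a != 0 -> involutive (reflV a).
Proof.
move=> a0 v; rewrite /reflV -!scaleNr corootD corootZ coroot_diag // -addrA -scalerDl.
by rewrite [X in X *: a](_ : _ = 0) ?scale0r ?addr0 //; ring.
Qed.

Lemma dotp_reflV2 a u v : a != 0 -> dotp (reflV a u) (reflV a v) = dotp u v.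
Proof. by move=> a0; rewrite dotp_reflV // reflVK. Qed.

Lemma coroot_reflV a b v : a != 0 -> coroot (reflV a b) v = coroot b (reflV a v).
Proof. by move=> a0; rewrite /coroot dotp_reflV2 // -dotp_reflV. Qed.

Lemma reflV_is_linear a : linear (reflV a).
Proof.
move=> c u v; rewrite /reflV corootD corootZ scalerBr scalerDl scalerA opprD.
by rewrite addrACA.
Qed.

Lemma reflV_conj a b v : a != 0 ->
  reflV (reflV a b) v = reflV a (reflV b (reflV a v)).
Proof.
move=> a0; rewrite {1}/reflV coroot_reflV //; set w := reflV a v.
have -> : reflV b w = - coroot b w *: b + w by rewrite scaleNr addrC.
by rewrite reflV_is_linear reflVK // scaleNr addrC.
Qed.

Lemma corootZl a c v : c != 0 -> coroot (c *: a) v = c^-1 * coroot a v.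
Proof.
move=> c0; rewrite /coroot dotpZl !dotpZr; have [->|a0] := eqVneq (dotp a a) 0.
  by rewrite !mulr0 invr0 !mulr0.
by field; rewrite c0 a0.
Qed.

Lemma reflVZ a c v : c != 0 -> reflV (c *: a) v = reflV a v.
Proof.
move=> c0; rewrite /reflV corootZl // scalerA.
by congr (_ - _ *: _); field.
Qed.

End EuclideanReflections.

(** * Reflections of roots, fundamental weights, signs of coroot coefficients *)

Section RootSystemTheory.
Variables (K : realType) (P : pred K) (F : subFieldType P) (n : nat).
Variables (R : {fset 'rV[K]_n}) (B : {set R}).
Hypotheses (hR : root_system R) (hC : coroots_in P R) (hB : root_basis B).
Implicit Types (a b : R) (u v : Fspan F R) (c : F).

Lemma root_neq0 a : val a != 0.
Proof. by apply: contraTneq (fsvalP a) => ->; exact: hR.1. Qed.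

Definition srefl a b : R := [` hR.2 _ _ (fsvalP a) (fsvalP b)]%fset.

(** The opposite root, written as a reflection so that it lies in [R] by construction. *)
Definition sneg a : R := srefl a a.

Lemma val_srefl a b : val (srefl a b) = reflV (val a) (val b).
Proof. by []. Qed.

Lemma val_sneg a : val (sneg a) = - val a.
Proof. exact: reflV_diag (root_neq0 a). Qed.

Lemma sneg_inv : involutive sneg.
Proof. by move=> a; apply: val_inj; rewrite !val_sneg opprK. Qed.

Lemma sreflK a : involutive (srefl a).
Proof. by move=> b; apply: val_inj; rewrite !val_srefl reflVK ?root_neq0. Qed.

Lemma srefl_conj a b d : srefl (srefl a b) d = srefl a (srefl b (srefl a d)).
Proof. by apply: val_inj; rewrite !val_srefl reflV_conj ?root_neq0. Qed.

Lemma srefl_proportional a b (c : K) : c != 0 -> val a = c *: val b -> srefl a =1 srefl b.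
Proof. by move=> c0 h d; apply: val_inj; rewrite !val_srefl h reflVZ. Qed.

Lemma srefl_diag a : srefl a a = sneg a.
Proof. by []. Qed.

Lemma val_FspanZ c v : val (c *: v) = (val c : K) *: val v.
Proof. by []. Qed.

(** An element of the span is an [F]-combination of roots, so [coroots_in P R] puts its coroot
    values in [F] and the default of [insubd] is never reached. *)
Lemma val_corootF a v : val (corootF a v) = coroot (val a) (val v) :> K.
Proof.
rewrite /corootF insubdK //; case: v => v /= /asboolP[c ->].
rewrite coroot_sum.
have -> : \sum_b coroot (val a) (val (c b) *: val b) =
    val (\sum_(b : R) c b * insubd (0 : F) (coroot (val a) (val b)) : F) :> K.
  rewrite raddf_sum; apply: eq_bigr => b _.
  rewrite [RHS]rmorphM corootZ; congr (_ * _).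
  by apply/esym/insubdK; exact: hC (fsvalP a) (fsvalP b).
exact: valP.
Qed.

Lemma corootF_linear a c u v :
  corootF a (c *: u + v) = c * corootF a u + corootF a v.
Proof.
apply: val_inj; rewrite rmorphD rmorphM /= !val_corootF -corootZ -corootD.
by rewrite raddfD /= ?val_FspanZ.
Qed.

Lemma corootFD a u v : corootF a (u + v) = corootF a u + corootF a v.
Proof. by have := corootF_linear a 1 u v; rewrite scale1r mul1r. Qed.

Lemma corootF0 a : corootF a (0 : Fspan F R) = 0.
Proof. by apply: (addrI (corootF a 0)); rewrite -corootFD !addr0. Qed.

Lemma corootFZ a c u : corootF a (c *: u) = c * corootF a u.
Proof. by have := corootF_linear a c u 0; rewrite corootF0 !addr0. Qed.

Lemma corootF_sum (I : finType) (Q : pred I) a (f : I -> Fspan F R) :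
  corootF a (\sum_(i | Q i) f i) = \sum_(i | Q i) corootF a (f i).
Proof. by elim/big_rec2: _ => [|i x y _ <-]; rewrite ?corootF0 ?corootFD. Qed.

Lemma corootF_diag a : corootF a (root_span F a) = 2.
Proof. by apply: val_inj; rewrite val_corootF /= coroot_diag ?root_neq0 // rmorph_nat. Qed.

Lemma corootF_srefl a b v : corootF (srefl a b) v = corootF b (reflF a v).
Proof.
apply: val_inj; rewrite !val_corootF val_srefl coroot_reflV ?root_neq0 //.
by congr coroot; rewrite /reflF raddfB /= ?val_FspanZ val_corootF.
Qed.

Lemma corootF_sneg a v : corootF (sneg a) v = - corootF a v.
Proof.
apply: val_inj; rewrite raddfN /= !val_corootF val_sneg -scaleN1r corootZl.
  by rewrite invrN1 mulN1r.
by rewrite oppr_eq0 oner_eq0.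
Qed.

Lemma reflF_linear a c u v : reflF a (c *: u + v) = c *: reflF a u + reflF a v.
Proof.
rewrite /reflF corootF_linear scalerBr scalerDl scalerA opprD.
by rewrite addrACA.
Qed.

(** The basis spans every root over [K], so [v] is orthogonal to all roots; being a combination of
    roots, it is orthogonal to itself. *)
Lemma Fspan_sep v : (forall b, b \in B -> corootF b v = 0) -> v = 0.
Proof.
move=> h; apply: val_inj; rewrite raddf0; apply/eqP; rewrite -[_ == _]negbK -dotp_gt0.
suff h0 a : dotp (val a) (val v) = 0.
  have /asboolP[c hc] := valP v; rewrite [X in dotp X _]hc.
  rewrite dotp_suml big1 ?ltxx // => a _.
  by rewrite dotpZl h0 mulr0.
have [c [-> _]] := hB.2 a; rewrite dotp_suml big1 // => b bB; rewrite dotpZl.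
have /(congr1 (val : F -> K)) := h b bB; rewrite rmorph0 val_corootF dotpC /coroot => /eqP.
by rewrite !mulf_eq0 invr_eq0 (negbTE (dotp_neq0 (root_neq0 b))) orbF
  pnatr_eq0 /= => /eqP ->; rewrite mulr0.
Qed.

(** Fundamental weights with coefficients in [F]. A relation between the rows of the Cartan matrix
    gives a combination of simple roots killed by all simple coroots, hence zero by [Fspan_sep],
    against the freeness of [B]. The rows of the inverse matrix are the coefficients. *)
Lemma dual_basis : exists q : R -> Fspan F R,
  {in B &, forall b b', corootF b (q b') = (b == b')%:R}.
Proof.
pose C : 'M[F]_#|B| := \matrix_(i, j) corootF (enum_val j) (root_span F (enum_val i)).
have Cu : C \in unitmx.
  rewrite -row_free_unit; apply: inj_row_free => t tC.
  have h0 : \sum_i t 0 i *: root_span F (enum_val i) = 0 :> Fspan F R.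
    apply: Fspan_sep => b bB; rewrite corootF_sum.
    have := congr1 (fun M : 'rV_#|B| => M 0 (enum_rank_in bB b)) tC.
    rewrite !mxE => {2}<-; apply: eq_bigr => i _.
    by rewrite corootFZ !mxE enum_rankK_in.
  have /freeP/(_ (fun i => val (t 0 i))) hf : free (image_tuple val B) by exact: hB.1.
  apply/rowP => i; rewrite mxE; apply: val_inj; rewrite rmorph0.
  apply: hf; have /(congr1 val) := h0; rewrite raddf0 raddf_sum => h0'; rewrite -[RHS]h0'.
  apply: eq_bigr => j _; rewrite [RHS]val_FspanZ; congr (_ *: _).
  by rewrite (nth_map (enum_val j)) -?cardE // -enum_val_nth.
(* [enum_rank_in] needs a proof of membership in [B], whence the match; the value 0 outside [B] is
   arbitrary. *)
exists (fun b => if @idP (b \in B) is ReflectT bB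
   then \sum_i invmx C (enum_rank_in bB b) i *: root_span F (enum_val i) else 0).
move=> b b' bB bB'; case: {-}_ / idP => // hb'; rewrite corootF_sum.
transitivity ((invmx C *m C) (enum_rank_in hb' b') (enum_rank_in bB b)).
  by rewrite mxE; apply: eq_bigr => i _; rewrite corootFZ mxE enum_rankK_in.
rewrite mulVmx // mxE eq_sym; congr (_%:R); apply: congr1.
apply/eqP/eqP => [/(congr1 enum_val)|e]; first by rewrite !enum_rankK_in.
by apply: enum_val_inj; rewrite !enum_rankK_in.
Qed.

Definition qweight : R -> Fspan F R := sval (cid dual_basis).

Lemma corootF_qweight : {in B &, forall b b', corootF b (qweight b') = (b == b')%:R}.
Proof. exact: svalP (cid dual_basis). Qed.

Lemma Fspan_expand v : v = \sum_(b in B) corootF b v *: qweight b.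
Proof.
apply/eqP; rewrite -subr_eq0; apply/eqP; apply: Fspan_sep => b bB.
rewrite -scaleN1r addrC corootF_linear corootF_sum (bigD1 b) //= big1; last first.
  by move=> d /andP[dB db]; rewrite corootFZ corootF_qweight // eq_sym (negbTE db) mulr0.
by rewrite addr0 corootFZ corootF_qweight // eqxx mulr1 mulN1r addNr.
Qed.

(* The coefficient of [a^vee] along [b^vee] for [b] in [B]. *)
Definition coef a b : F := corootF a (qweight b).

Lemma corootF_coef a v : corootF a v = \sum_(b in B) coef a b * corootF b v.
Proof.
rewrite {1}[v]Fspan_expand corootF_sum; apply: eq_bigr => b _.
by rewrite corootFZ mulrC.
Qed.

(** As [a^vee = 2a / (a, a)], passing from roots to coroots multiplies each coefficient by a
    positive ratio of squared lengths, so signs agree. *)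
Lemma val_coef a (c : R -> K) b : b \in B ->
  val a = \sum_(d in B) c d *: val d ->
  val (coef a b) = c b * (dotp (val b) (val b) / dotp (val a) (val a)).
Proof.
move=> bB ha; rewrite /coef val_corootF {1}/coroot dotpC {1}ha dotp_suml.
rewrite (bigD1 b) //= big1 => [|d /andP[dB db]].
  have /(congr1 val) := corootF_qweight bB bB.
  rewrite eqxx rmorph1 val_corootF /coroot dotpZl dotpC => h.
  have b0 := dotp_neq0 (root_neq0 b); rewrite addr0.
  have <- : 2 * dotp (val b) (val (qweight b)) = dotp (val b) (val b).
    by rewrite -[RHS]mul1r -[in RHS]h divfK // dotpC.
  ring.
have /(congr1 val) := corootF_qweight dB bB.
rewrite (negbTE db) rmorph0 val_corootF /coroot dotpZl => /eqP.
rewrite !mulf_eq0 invr_eq0 (negbTE (dotp_neq0 (root_neq0 d))) orbF pnatr_eq0 /=.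
by rewrite dotpC => /eqP ->; rewrite mulr0.
Qed.

Lemma coef_neq0 a : ~ (forall b, b \in B -> coef a b = 0).
Proof.
move=> h; have := corootF_diag a; rewrite corootF_coef big1 => [|b /h ->].
  by move=> /(congr1 val)/eqP; rewrite rmorph0 rmorph_nat eq_sym pnatr_eq0.
by rewrite mul0r.
Qed.

Lemma dotp_ratio_gt0 a b : 0 < dotp (val b) (val b) / dotp (val a) (val a).
Proof. by rewrite divr_gt0 ?dotp_gt0 ?root_neq0. Qed.

Lemma pos_coef_ge0 a b : pos_root B a -> b \in B -> 0 <= (val (coef a b) : K).
Proof.
move=> /asboolP[c [ha hc]] bB; rewrite (val_coef bB ha).
by rewrite mulr_ge0 ?hc // ltW // dotp_ratio_gt0.
Qed.

Lemma coef_sneg a b : coef (sneg a) b = - coef a b.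
Proof. exact: corootF_sneg. Qed.

Lemma pos_or_neg a : pos_root B a || pos_root B (sneg a).
Proof.
have [c [ha [hc|hc]]] := hB.2 a; apply/orP; [left|right]; apply/asboolP.
  by exists c.
exists (fun b => - c b); split=> [|b bB]; last by rewrite oppr_ge0 hc.
by rewrite val_sneg ha -sumrN; apply: eq_bigr => b _; rewrite scaleNr.
Qed.

Lemma pos_sneg a : pos_root B (sneg a) = ~~ pos_root B a.
Proof.
have := pos_or_neg a; case: (boolP (pos_root B a)) => //= pa _.
apply/negP => na; apply: (@coef_neq0 a) => b bB; apply: val_inj; rewrite rmorph0.
apply/le_anti; rewrite pos_coef_ge0 // andbT -oppr_ge0 -raddfN -coef_sneg.
exact: pos_coef_ge0.
Qed.

(** All coefficients of a root have one sign, so a single positive one decides. *)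
Lemma pos_rootP a b : b \in B -> 0 < (val (coef a b) : K) -> pos_root B a.
Proof.
move=> bB h; rewrite -[pos_root B a]negbK -pos_sneg; apply/negP => na.
have := pos_coef_ge0 na bB; rewrite coef_sneg raddfN oppr_ge0 => h'.
by have := lt_le_trans h h'; rewrite ltxx.
Qed.

Lemma basis_pos b : b \in B -> pos_root B b.
Proof.
move=> bB; apply: (pos_rootP bB); rewrite /coef corootF_qweight // eqxx.
by rewrite rmorph1 ltr01.
Qed.

Lemma reflF_qweight b b' : b \in B -> b' \in B -> b != b' ->
  reflF b (qweight b') = qweight b'.
Proof.
by move=> bB bB' h; rewrite /reflF corootF_qweight // (negbTE h) scale0r subr0.
Qed.

(** A simple reflection changes only the coefficient along [b]. A positive coefficient elsewhere
    survives and keeps the root positive; otherwise [a] is a multiple of [b], possibly not [b]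
    itself as [R] may be non-reduced. *)
Lemma simple_srefl b a : b \in B -> pos_root B a ->
  pos_root B (srefl b a) \/ exists2 c : K, 0 < c & val a = c *: val b.
Proof.
move=> bB pa; case: (pselect (exists2 d, d \in B & (d != b) && (coef a d != 0))).
  move=> [d dB /andP[db h]]; left; apply: (pos_rootP dB).
  rewrite /coef corootF_srefl reflF_qweight // 1?eq_sym //.
  rewrite lt_neqAle pos_coef_ge0 // andbT eq_sym; apply: contra_neq h => h.
  by apply: val_inj; rewrite rmorph0.
move=> h; right; case/asboolP: (pa) => c [ha hc].
have c0 d : d \in B -> d != b -> c d = 0.
  move=> dB db; apply/eqP; apply: contra_notT h => cd.
  exists d; rewrite // db /=; apply/eqP => /(congr1 val)/eqP.
  by rewrite rmorph0 (val_coef dB ha) mulf_eq0 (negbTE cd) (gt_eqF (dotp_ratio_gt0 _ _)).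
have ha' : val a = c b *: val b.
  by rewrite ha (bigD1 b) //= big1 ?addr0 // => d /andP[dB db]; rewrite c0 // scale0r.
exists (c b) => //; rewrite lt_neqAle hc // andbT eq_sym.
by apply: contraNneq (root_neq0 a) => h0; rewrite ha' h0 scale0r.
Qed.

End RootSystemTheory.

(** * The model space and its Weyl group *)

Section ModelSpaceTheory.
Variables (K : realType) (P : pred K) (F : subFieldType P) (n : nat).
Variables (R : {fset 'rV[K]_n}) (L : ordLmodType F) (B : {set R}).
Hypotheses (hR : root_system R) (hC : coroots_in P R) (hB : root_basis B).
Local Notation A := (model_space R L).
Local Notation srefl := (srefl hR).
Local Notation sneg := (sneg hR).
Local Notation qweight := (qweight F hR hC hB).
Local Notation coef := (coef F hR hC hB).
Implicit Types (a b : R) (x y z : A) (l : L) (u v : Fspan F R).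

Lemma tensDl u v l : tens (u + v) l = tens u l + tens v l :> A.
Proof. by have := (tens_bilinear (Fspan F R) L).1 l 1 u v; rewrite !scale1r. Qed.

Lemma tensZl c v l : tens (c *: v) l = c *: tens v l :> A.
Proof. exact: bilinearZl (tens_bilinear _ _). Qed.

Lemma tensDr v l l' : tens v (l + l') = tens v l + tens v l' :> A.
Proof. by have := (tens_bilinear (Fspan F R) L).2 v 1 l l'; rewrite !scale1r. Qed.

Lemma tensZr c v l : tens v (c *: l) = c *: tens v l :> A.
Proof.
have := (tens_bilinear (Fspan F R) L).2 v c l 0.
by rewrite (bilinear0r _ (tens_bilinear _ _)) !addr0.
Qed.

Lemma linear_tens_ext (U : lmodType F) (f g : A -> U) : linear f -> linear g ->
  (forall v l, f (tens v l) = g (tens v l)) -> f =1 g.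
Proof.
move=> hf hg h x.
have h0 (k : A -> U) : linear k -> k 0 = 0.
  by move=> hk; have := hk (-1) 0 0; rewrite scaler0 addr0 scaleN1r addNr.
rewrite (tens_gen x); elim: (repr x) => [|p s ih]; first by rewrite big_nil !h0.
rewrite big_cons; have := hf 1 (tens p.1 p.2) (\sum_(j <- s) tens j.1 j.2).
have := hg 1 (tens p.1 p.2) (\sum_(j <- s) tens j.1 j.2).
by rewrite !scale1r => -> ->; rewrite ih h.
Qed.

Lemma pairing_bilinear a : bilinear_map (fun v l => corootF a v *: l : L).
Proof.
split=> [l c u v|v c l l']; first by rewrite corootF_linear // scalerDl scalerA.
by rewrite scalerDr !scalerA mulrC.
Qed.

Lemma pairing_linear a : linear (fun x => pairing x a).
Proof. exact/tlift_linear/pairing_bilinear. Qed.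

Lemma pairing_tens a v l : pairing (tens v l : A) a = corootF a v *: l.
Proof. by rewrite /pairing tlift_tens //; exact: pairing_bilinear. Qed.

Lemma pairingD a x y : pairing (x + y) a = pairing x a + pairing y a.
Proof. by have := pairing_linear a 1 x y; rewrite !scale1r. Qed.

Lemma pairing0 a : pairing (0 : A) a = 0.
Proof. by apply: (addrI (pairing 0 a)); rewrite -pairingD !addr0. Qed.

Lemma pairingZ a c x : pairing (c *: x) a = c *: pairing x a.
Proof. by have := pairing_linear a c x 0; rewrite pairing0 !addr0. Qed.

Lemma pairingN a x : pairing (- x) a = - pairing x a.
Proof. by rewrite -scaleN1r pairingZ scaleN1r. Qed.

Lemma pairingB a x y : pairing (x - y) a = pairing x a - pairing y a.
Proof. by rewrite pairingD pairingN. Qed.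

Lemma pairing_sum (I : finType) (Q : pred I) a (f : I -> A) :
  pairing (\sum_(i | Q i) f i) a = \sum_(i | Q i) pairing (f i) a.
Proof. by elim/big_rec2: _ => [|i x y _ <-]; rewrite ?pairing0 ?pairingD. Qed.

Lemma refl_bilinear a : bilinear_map (fun v l => tens (reflF a v) l : A).
Proof.
split=> [l c u v|v c l l']; first by rewrite reflF_linear // tensDl tensZl.
by rewrite tensDr tensZr.
Qed.

Lemma refl_linear a : linear (@refl _ _ _ _ R L a).
Proof. exact/tlift_linear/refl_bilinear. Qed.

Lemma refl_tens a v l : refl a (tens v l : A) = tens (reflF a v) l.
Proof. by rewrite /refl tlift_tens //; exact: refl_bilinear. Qed.

Lemma pairing_refl a b x : pairing (refl a x) b = pairing x (srefl a b).
Proof.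
move: x; apply: linear_tens_ext => [c x y||v l].
- by rewrite (refl_linear a) (pairing_linear b).
- exact: pairing_linear.
by rewrite refl_tens !pairing_tens corootF_srefl.
Qed.

Lemma reflE a x : refl a x = x - tens (root_span F a) (pairing x a).
Proof.
move: x; apply: linear_tens_ext => [|c x y|v l].
- exact: refl_linear.
- by rewrite (pairing_linear a) tensDr tensZr scalerBr opprD addrACA.
by rewrite refl_tens pairing_tens tensZr -tensZl /reflF tensDl -scaleNr tensZl -scaleNr -tensZl.
Qed.

Lemma model_expand x : x = \sum_(b in B) tens (qweight b) (pairing x b).
Proof.
move: x; apply: linear_tens_ext => [//|c x y|v l].
  rewrite scaler_sumr -big_split; apply: eq_bigr => b _ /=.
  by rewrite (pairing_linear b) tensDr tensZr.
rewrite {1}(Fspan_expand hR hC hB v).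
transitivity (\sum_(b in B) corootF b v *: tens (qweight b) l : A).
  elim/big_rec2: _ => [|b x y _ <-]; last by rewrite tensDl tensZl.
  exact: (bilinear0l _ (tens_bilinear _ _)).
by apply: eq_bigr => b _; rewrite pairing_tens tensZr.
Qed.

Lemma pairing_ext x y : (forall b, b \in B -> pairing x b = pairing y b) -> x = y.
Proof.
move=> h; rewrite (model_expand x) (model_expand y).
by apply: eq_bigr => b /h ->.
Qed.

Lemma pairing_coef a x : pairing x a = \sum_(b in B) coef a b *: pairing x b.
Proof.
rewrite {1}(model_expand x) pairing_sum; apply: eq_bigr => b _.
by rewrite pairing_tens.
Qed.

Definition of_coords (f : R -> L) : A := \sum_(b in B) tens (qweight b) (f b).

Lemma pairing_of_coords f b : b \in B -> pairing (of_coords f) b = f b.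
Proof.
move=> bB; rewrite pairing_sum (bigD1 b) //= big1 => [|d /andP[dB db]].
  by rewrite pairing_tens corootF_qweight // eqxx scale1r addr0.
by rewrite pairing_tens corootF_qweight // eq_sym (negbTE db) scale0r.
Qed.

Lemma reflK a : involutive (@refl _ _ _ _ R L a).
Proof. by move=> x; apply: pairing_ext => b _; rewrite !pairing_refl sreflK. Qed.

Lemma pairing_sneg a x : pairing x (sneg a) = - pairing x a.
Proof.
rewrite !pairing_coef -sumrN; apply: eq_bigr => b _.
by rewrite coef_sneg scaleNr.
Qed.

Lemma pairing_pos_ge0 a x : x \in fund_chamber B -> pos_root B a -> 0 <= pairing x a.
Proof.
rewrite inE => hx pa; rewrite pairing_coef; apply: ordmod_sumr_ge0 => b bB.
by rewrite ordmod_scale_ge0 ?hx // pos_coef_ge0.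
Qed.

Lemma pairing_coroot_proportional a b (t : F) : (forall v, corootF a v = t * corootF b v) ->
  forall x, pairing x a = t *: pairing x b.
Proof.
move=> h; apply: linear_tens_ext => [|k y z|v l]; first exact: pairing_linear.
  by rewrite (pairing_linear b) scalerDr !scalerA mulrC.
by rewrite !pairing_tens h scalerA.
Qed.

(** The ratio [c] is only known in [K] and cannot act on [L], but [c^-1] is half of [<b, a^vee>],
    which lies in [F]. *)
Lemma pairing_proportional a b (c : K) : 0 < c -> val a = c *: val b ->
  exists2 c' : F, 0 < (val c' : K) & forall x : A, pairing x a = c' *: pairing x b.
Proof.
move=> c0 h.
have hv v : val (corootF a v) = c^-1 * val (corootF b v).
  by rewrite !val_corootF // h corootZl // gt_eqF.
pose t := corootF a (root_span F b) / 2.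
have ht : val t = c^-1.
  rewrite /t rmorphM fmorphV rmorph_nat /= hv corootF_diag // rmorph_nat mulfK //.
  by rewrite pnatr_eq0.
exists t => [|y]; first by rewrite ht invr_gt0.
apply: pairing_coroot_proportional => v; apply: val_inj.
by rewrite hv rmorphM /= ht.
Qed.

End ModelSpaceTheory.

(** * Orbits of the spherical Weyl group and the exchange argument *)

Section WeylGroupTheory.
Variables (K : realType) (P : pred K) (F : subFieldType P) (n : nat).
Variables (R : {fset 'rV[K]_n}) (L : ordLmodType F) (B : {set R}).
Hypotheses (hR : root_system R) (hC : coroots_in P R) (hB : root_basis B).
Local Notation A := (model_space R L).
Local Notation srefl := (srefl hR).
Local Notation sneg := (sneg hR).
Local Notation C := (fund_chamber B : set A).
Implicit Types (a b : R) (x y z : A) (s t : seq R) (w : A -> A).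

Lemma sph_weyl_comp w w' : sph_weyl w -> sph_weyl w' -> sph_weyl (w \o w').
Proof.
by elim=> [|a u _ ih] // h; exact: (sph_weyl_refl a (ih h)).
Qed.

Lemma sph_weyl_linear w : sph_weyl w -> linear w.
Proof.
elim=> [|a u _ ih] c x y //=.
by rewrite ih refl_linear.
Qed.

Lemma sph_weylD w x y : sph_weyl w -> w (x + y) = w x + w y.
Proof. by move=> /sph_weyl_linear h; have := h 1 x y; rewrite !scale1r. Qed.

Lemma sph_weyl0 w : sph_weyl w -> w 0 = 0.
Proof. by move=> h; apply: (addrI (w 0)); rewrite -sph_weylD // !addr0. Qed.

Lemma sph_weylN w x : sph_weyl w -> w (- x) = - w x.
Proof.
by move=> h; apply: (addrI (w x)); rewrite -sph_weylD // !subrr sph_weyl0.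
Qed.

Lemma sph_weylB w x y : sph_weyl w -> w (x - y) = w x - w y.
Proof. by move=> h; rewrite sph_weylD // sph_weylN. Qed.

Lemma sph_weyl_inv w : sph_weyl w ->
  exists w', [/\ sph_weyl w', cancel w w' & cancel w' w].
Proof.
elim=> [|a u _ [u' [h1 h2 h3]]]; first by exists id; split=> //; constructor.
exists (u' \o @refl _ _ _ _ R L a); split=> [|x|x] /=.
- by apply: sph_weyl_comp h1 (sph_weyl_refl a (sph_weyl_id R L)).
- by rewrite (reflK hR hC hB) h2.
- by rewrite h3 (reflK hR hC hB).
Qed.

(** Here [f] is the permutation of the roots by the inverse of [w]. *)
Lemma sph_weyl_roots w : sph_weyl w ->
  exists2 f : R -> R, injective f & forall x a, pairing (w x) a = pairing x (f a).
Proof.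
elim=> [|a u _ [f fI hf]]; first by exists id.
exists (f \o srefl a) => [|x b /=]; last by rewrite (pairing_refl hR hC) hf.
exact: inj_comp fI (inv_inj (sreflK hR a)).
Qed.

(** Letters are arbitrary roots; words in simple reflections are singled out by
    [{subset s <= B}]. *)
Definition sword s x : A := foldr (@refl _ _ _ _ R L) x s.

Lemma sword_cat s t x : sword (s ++ t) x = sword s (sword t x).
Proof. exact: foldr_cat. Qed.

Lemma sword_rev s x : sword (rev s) (sword s x) = x.
Proof.
elim: s => [|a s ih] //=; rewrite rev_cons -cats1 sword_cat /=.
by rewrite (reflK hR hC hB) ih.
Qed.

Lemma sword_weyl s : sph_weyl (sword s).
Proof. by elim: s => [|a s ih]; [exact: sph_weyl_id|exact: sph_weyl_refl]. Qed.

Lemma refl_sneg a x : refl (sneg a) x = refl a x.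
Proof.
apply: (pairing_ext hR hC hB) => b _; rewrite !(pairing_refl hR hC).
congr pairing; apply: (@srefl_proportional _ _ _ _ _ _ (-1)); rewrite ?oppr_eq0 ?oner_eq0 //.
by rewrite val_sneg scaleN1r.
Qed.

Lemma pairing_refl_diag a x : pairing (refl a x) a = - pairing x a.
Proof. by rewrite (pairing_refl hR hC) (pairing_sneg hR hC hB). Qed.

Lemma refl_fix a x : pairing x a = 0 -> refl a x = x.
Proof.
move=> h; rewrite reflE // h (bilinear0r _ (tens_bilinear _ _)) subr0 //.
Qed.

Lemma fund_chamberPn x : x \notin C -> exists2 b, b \in B & pairing x b < 0.
Proof.
move=> h; apply: contrapT => h'; move/negP: h; apply; rewrite inE => b bB.
by rewrite ordmod_leNgt; apply/negP => hb; apply: h'; exists b.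
Qed.

Lemma pairing_simple_refl b a : b \in B -> pos_root B a ->
  pos_root B (srefl b a) \/
  exists2 c : F, 0 < (val c : K) &
    forall x, pairing (refl b x) a = - (c *: pairing x b).
Proof.
move=> bB pa; case: (simple_srefl F hR hC hB bB pa) => [|[c c0 h]]; first by left.
right; have [c' c'0 hc] := pairing_proportional L hR hC c0 h; exists c' => //.
by move=> x; rewrite hc pairing_refl_diag scalerN.
Qed.

(** Inversion set attached to a point instead of a group element; it is empty exactly on the
    fundamental chamber. *)
Definition inversions x : {set R} :=
  finset (fun a => pos_root B a && (pairing x a < 0)).

(** The reflection in [b] maps the inversions of [refl b x] injectively to inversions of [x] other
    than [b]: positive multiples of [b] are positive on [refl b x], and the other positive roots
    stay positive. *)
Lemma card_inversions b x : b \in B -> pairing x b < 0 ->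
  (#|inversions (refl b x)| < #|inversions x|)%N.
Proof.
move=> bB hb; have pb := basis_pos F hR hC hB bB.
rewrite -(card_imset _ (inv_inj (sreflK hR b))).
have bI : b \in inversions x by rewrite inE pb.
rewrite (cardsD1 b (inversions x)) bI add1n ltnS.
apply/subset_leq_card/fintype.subsetP => _ /imsetP[a + ->]; rewrite !inE => /andP[pa].
rewrite (pairing_refl hR hC) => ha; rewrite ha andbT.
case: (pairing_simple_refl bB pa) => [pa'|[c c0 hc]].
  rewrite pa' andbT; apply: contraL pa => /eqP /(congr1 (srefl b)).
  by rewrite sreflK => ->; rewrite srefl_diag (pos_sneg F hR hC hB) pb.
move: ha; rewrite -(pairing_refl hR hC) hc ordmod_oppr_lt0 ordmod_scale_gt0 // => h.
by have := lt_trans h hb; rewrite ltxx.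
Qed.

Lemma exists_dominant x : exists s, {subset s <= B} /\ sword s x \in C.
Proof.
have [m] := ubnP #|inversions x|; elim: m x => // m ih x hm.
have [xC|/fund_chamberPn[b bB hb]] := boolP (x \in C); first by exists [::].
have [|s [sB hs]] := ih (refl b x).
  exact: leq_trans (card_inversions bB hb) _.
exists (s ++ [:: b]); rewrite sword_cat; split=> // d.
by rewrite mem_cat => /orP[/sB //|]; rewrite inE => /eqP ->.
Qed.

(* The exchange condition: a letter of [s] can be deleted. *)
Lemma exchange s x a : x \in C -> {subset s <= B} -> pos_root B a ->
  pairing (sword s x) a < 0 ->
  exists s', [/\ {subset s' <= B}, (size s' < size s)%N &
                 sword s' x = refl a (sword s x)].
Proof.
move=> xC; elim: s a => [|b s ih] a sB pa /= h.
  have := lt_le_trans h (pairing_pos_ge0 hR hC hB xC pa).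
  by rewrite ltxx.
have bB : b \in B by apply: sB; rewrite inE eqxx.
have sB' : {subset s <= B} by move=> d ds; apply: sB; rewrite inE ds orbT.
case: (simple_srefl F hR hC hB bB pa) => [pa'|[c c0 hc]]; last first.
  (* [a] is a multiple of [b]: both give the same reflection, and the deleted letter is [b]. *)
  exists s; split=> //; rewrite -[LHS](reflK hR hC hB b).
  apply: (pairing_ext hR hC hB) => d _; rewrite !(pairing_refl hR hC).
  by rewrite (srefl_proportional hR (lt0r_neq0 c0) hc).
rewrite (pairing_refl hR hC) in h.
have [s' [s'B hs e]] := ih _ sB' pa' h; exists (b :: s'); split=> //.
  by move=> d; rewrite inE => /orP[/eqP -> //|/s'B].
rewrite /= e; apply: (pairing_ext hR hC hB) => d _; rewrite !(pairing_refl hR hC).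
by rewrite srefl_conj !sreflK.
Qed.

Lemma dominant_unique_word s x : x \in C -> {subset s <= B} ->
  sword s x \in C -> sword s x = x.
Proof.
move=> xC; have [m] := ubnP (size s); elim: m s => // m ih [//|b s] hm sB hz.
have bB : b \in B by apply: sB; rewrite inE eqxx.
have sB' : {subset s <= B} by move=> d ds; apply: sB; rewrite inE ds orbT.
have := pairing_pos_ge0 hR hC hB hz (basis_pos F hR hC hB bB).
rewrite /= pairing_refl_diag ordmod_oppr_ge0 le_eqVlt => /orP[/eqP h|h].
  by move: hz; rewrite /= refl_fix //; exact: ih.
have [s' [s'B hs e]] := exchange xC sB' (basis_pos F hR hC hB bB) h.
move: hz; rewrite /= -e; apply: ih => //.
by apply: leq_trans hs _; rewrite -ltnS ltnW.
Qed.

(** Arbitrary reflections are replaced one at a time by words in simple ones, using [exchange] when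
    [a] is negative on the current point [z]. *)
Lemma orbit_dominant w x : sph_weyl w -> x \in C ->
  exists s, {subset s <= B} /\ w x = sword s x.
Proof.
move=> hw xC; elim: hw => [|a u _ [s [sB hs]]]; first by exists [::].
rewrite /= hs {u hs}; set z := sword s x.
wlog pa : a / pos_root B a.
  move=> wl; have /orP[/wl //|/wl] := pos_or_neg hR hB a.
  by rewrite refl_sneg.
have [za|za] := boolP (pairing z a < 0).
  by have [s' [h1 _ h2]] := exchange xC sB pa za; exists s'.
have [za0|za0] := eqVneq (pairing z a) 0; first by exists s; rewrite refl_fix.
have za1 : pairing (refl a z) a < 0.
  by rewrite pairing_refl_diag ordmod_oppr_lt0 lt_neqAle eq_sym za0 ordmod_leNgt.
(* When [a] is positive on [z], exchange is run backwards: from the dominant representative [y] of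
   [refl a z] it produces a simple word reaching [z]. Then [x] and [y] are dominant and joined by a
   simple word, hence equal. *)
have [t [tB tC]] := exists_dominant (refl a z).
set y := sword t (refl a z) in tC.
have rB r : {subset r <= B} -> {subset rev r <= B} by move=> h d; rewrite mem_rev => /h.
have yz : refl a z = sword (rev t) y by rewrite sword_rev.
rewrite yz in za1.
have [s' [s'B _ e]] := exchange tC (rB _ tB) pa za1.
have xy : x = y.
  have e' : sword (rev s ++ s') y = x.
    by rewrite sword_cat e -yz (reflK hR hC hB) sword_rev.
  rewrite -e'; apply: dominant_unique_word => //; last by rewrite e'.
  by move=> d; rewrite mem_cat => /orP[/rB|]; auto.
by exists (rev t); rewrite yz xy; split=> //; exact: rB.
Qed.

Lemma dominant_unique w x : sph_weyl w -> x \in C -> w x \in C -> w x = x.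
Proof.
move=> hw xC; have [s [sB ->]] := orbit_dominant hw xC.
exact: dominant_unique_word.
Qed.

(** If [x] is dominant, so is [w x], and uniqueness applies. Otherwise both points have a common
    simple inversion; reflecting both in it keeps the inversion sets equal and makes them
    smaller. *)
Lemma inversions_inj w x : sph_weyl w -> inversions x = inversions (w x) -> w x = x.
Proof.
have [m] := ubnP #|inversions x|; elim: m x w => // m ih x w hm hw hI.
have hP y b : b \in B -> (b \in inversions y) = (pairing y b < 0).
  by move=> bB; rewrite inE (basis_pos F hR hC hB bB).
have [xC|/fund_chamberPn[b bB hb]] := boolP (x \in C).
  apply: dominant_unique => //; rewrite inE => b bB; rewrite ordmod_leNgt -hP //.
  by rewrite -hI hP // -ordmod_leNgt; move: xC; rewrite inE; exact.
have hb' : pairing (w x) b < 0 by rewrite -hP // -hI hP.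
(* Conjugation makes [w'] send [refl b x] to [refl b (w x)]. *)
pose w' := @refl _ _ _ _ R L b \o (w \o @refl _ _ _ _ R L b).
have hw' : sph_weyl w'.
  apply/sph_weyl_refl/sph_weyl_comp => //.
  exact: (sph_weyl_refl b (sph_weyl_id R L)).
apply: (inv_inj (reflK hR hC hB b)); rewrite -{1}[x](reflK hR hC hB b).
apply: (ih (refl b x) w' _ hw'); first exact: leq_trans (card_inversions bB hb) _.
rewrite /w' /= (reflK hR hC hB); apply/setP => a; rewrite !inE.
have [pa|//] := boolP (pos_root B a); rewrite /=.
case: (pairing_simple_refl bB pa) => [pa'|[c c0 hc]].
  have := congr1 (fun X : {set R} => srefl b a \in X) hI.
  by rewrite /= !inE pa' !(pairing_refl hR hC).
rewrite !hc !ordmod_oppr_lt0 !ordmod_scale_gt0 //.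
by rewrite !ordmod_ltNge (ltW hb) (ltW hb').
Qed.

End WeylGroupTheory.

(** * Segments *)

Section StandardMetric.
Variables (K : realType) (P : pred K) (F : subFieldType P) (n : nat).
Variables (R : {fset 'rV[K]_n}) (L : ordLmodType F) (B : {set R}).
Hypotheses (hR : root_system R) (hC : coroots_in P R) (hB : root_basis B).
Local Notation A := (model_space R L).
Local Notation srefl := (srefl hR).
Local Notation sneg := (sneg hR).
Local Notation C := (fund_chamber B : set A).
Local Notation d := (@standard_metric _ _ _ _ R L B).
Implicit Types (a b : R) (x y z : A) (w : A -> A).

(** Weyl elements permute all roots but not the positive ones; doubling turns the metric into a sum
    over all roots, where invariance is a reindexing. *)
Lemma sum_pos_roots (f : R -> L) : (forall a, f (sneg a) = f a) ->
  (\sum_(a | pos_root B a) f a) *+ 2 = \sum_a f a.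
Proof.
move=> h; rewrite [RHS](bigID (pos_root B)) /= mulr2n; congr (_ + _).
rewrite (reindex_inj (inv_inj (sneg_inv hR))) /=.
by apply: eq_big => [a|a _]; rewrite ?h // (pos_sneg F hR hC hB).
Qed.

Lemma standard_metric_sph_weyl w x y : sph_weyl w -> d (w x) (w y) = d x y.
Proof.
move=> hw; have [f fI hf] := sph_weyl_roots hR hC hw.
apply: (@mulr2n_inj _ _ F); rewrite !sum_pos_roots; last 2 first.
- by move=> a; rewrite (pairing_sneg hR hC hB) labsN.
- by move=> a; rewrite (pairing_sneg hR hC hB) labsN.
rewrite [RHS](reindex_inj fI); apply: eq_bigr => a _.
by rewrite -sph_weylB // hf.
Qed.

Lemma standard_metric_translation t x y : d (x + t) (y + t) = d x y.
Proof. by rewrite /standard_metric opprD addrACA subrr addr0. Qed.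

Lemma standard_metric_is_metric : is_metric d.
Proof.
have ge0 a x : 0 <= labs (pairing x a) by exact: labs_ge0.
split=> [x y|x y|x y|x y z].
- by apply: ordmod_sumr_ge0.
- split=> [h|->]; last first.
    by rewrite /standard_metric big1 // => a _; rewrite subrr pairing0 // labs0.
  apply/esym/eqP; rewrite -subr_eq0; apply/eqP/(pairing_ext hR hC hB) => b bB.
  rewrite pairing0 //; apply: labs_eq0.
  by apply: (ordmod_psumr_eq0 _ h); rewrite ?(basis_pos F hR hC hB).
- by apply: eq_bigr => a _; rewrite -opprB pairingN // labsN.
rewrite /standard_metric -big_split; apply: ordmod_ler_sum => a _ /=.
have -> : z - x = (y - x) + (z - y) by rewrite [RHS]addrC subrKA.
by rewrite pairingD // labsD.
Qed.

Lemma affine_weyl_isometry (T : set A) (g : A -> A) x y :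
  affine_weyl T g -> d (g x) (g y) = d x y.
Proof.
move=> [w [t [hw _ hg]]].
by rewrite !hg standard_metric_translation standard_metric_sph_weyl.
Qed.

(** Induction on [r]: if the tail can carry [m], the head gets 0; otherwise the tail is filled up
    and the head takes the remainder divided by its coefficient. *)
Lemma greedy_filling (I : eqType) (r : seq I) (k : I -> F) (v : I -> L) (m : L) :
  uniq r -> (forall i, 0 <= (val (k i) : K)) -> (forall i, 0 <= v i) ->
  0 <= m -> m <= \sum_(i <- r) k i *: v i ->
  exists u : I -> L, (forall i, 0 <= u i /\ u i <= v i) /\
    \sum_(i <- r) k i *: u i = m.
Proof.
move=> + hk hv; elim: r m => [|i r ih] m /= => [_|/andP[ir ur]] m0.
  rewrite big_nil => m1; exists (fun=> 0); split=> // .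
  by rewrite big_nil; apply/le_anti; rewrite m0 m1.
rewrite big_cons => m1; have [m2|m2] := boolP (m <= \sum_(j <- r) k j *: v j).
  have [u [hu su]] := ih m ur m0 m2.
  exists (fun j => if j == i then 0 else u j); split=> [j|].
    by case: eqP => _; split; rewrite ?hv //; have [] := hu j.
  rewrite big_cons eqxx scaler0 add0r -su; apply: eq_big_seq => j jr.
  by case: eqP ir => // <-; rewrite jr.
move: m2; rewrite -ordmod_ltNge -ordmod_subr_gt0; set m' := (_ - _) => m'0.
(* With a zero coefficient at the head, [m] would not exceed the sum over the tail. *)
have ki : 0 < (val (k i) : K).
  rewrite lt_neqAle hk andbT; apply/eqP => h0.
  have k0 : k i = 0 by apply: val_inj; rewrite rmorph0 -h0.
  move: m1; rewrite k0 scale0r add0r -ordmod_leN2 -(ordmod_leD2l m) subrr => h.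
  by have := lt_le_trans m'0 h; rewrite ltxx.
have ki0 : k i != 0 by apply: contraTneq ki => ->; rewrite rmorph0 ltxx.
exists (fun j => if j == i then (k i)^-1 *: m' else v j); split=> [j|].
  case: eqP => [->|_]; last by rewrite hv lexx.
  split; first by rewrite ordmod_scale_ge0 ?ltW // fmorphV invr_gt0.
  by rewrite -(ordmod_scale_le _ _ ki) scalerA mulfV // scale1r ordmod_leBlDr.
rewrite big_cons eqxx scalerA mulfV // scale1r -[RHS](subrK (\sum_(j <- r) k j *: v j)).
by congr (_ + _); apply: eq_big_seq => j jr; case: eqP ir => // <-; rewrite jr.
Qed.

Lemma box_level_dominant (v : A) a (m : L) : v \in C -> pos_root B a ->
  0 <= m -> m <= pairing v a ->
  exists u, [/\ pairing u a = m, u \in C & v - u \in C].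
Proof.
move=> vC pa m0; rewrite (pairing_coef hR hC hB) => m1.
have vB b : b \in B -> 0 <= pairing v b by move: vC; rewrite inE; exact.
(* Truncation outside [B], because [greedy_filling] asks for nonnegativity at every index. *)
pose v' b := if b \in B then pairing v b else 0.
pose k b := if b \in B then coef F hR hC hB a b else 0.
have [|||u [hu su]] := @greedy_filling _ (enum B) k v' m (enum_uniq _) _ _ m0.
- by move=> b; rewrite /k; case: ifP => bB; rewrite ?rmorph0 // pos_coef_ge0.
- by move=> b; rewrite /v'; case: ifP => bB; rewrite ?vB.
- apply: le_trans m1 _; rewrite big_enum /= le_eqVlt; apply/orP; left; apply/eqP.
  by apply: eq_bigr => b bB; rewrite /k /v' bB.
exists (of_coords hR hC hB u); split.
- rewrite (pairing_coef hR hC hB) -su big_enum; apply: eq_bigr => b bB.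
  by rewrite (pairing_of_coords hR hC hB) // /k bB.
- rewrite inE => b bB; rewrite (pairing_of_coords hR hC hB) //.
  by have [] := hu b.
rewrite inE => b bB; rewrite pairingB // (pairing_of_coords hR hC hB) //.
by rewrite ordmod_subr_ge0; have [] := hu b; rewrite /v' bB.
Qed.

(** After [v] is moved into the chamber, [u] and [v - u] are both dominant, so every root has weakly
    the same sign on the two and absolute values add up. *)
Lemma box_level (v : A) a (m : L) :
  (0 <= m /\ m <= pairing v a) \/ (m <= 0 /\ pairing v a <= m) ->
  exists u, pairing u a = m /\ forall b,
    labs (pairing v b) = labs (pairing u b) + labs (pairing (v - u) b).
Proof.
move=> hm; have [s [_ sC]] := exists_dominant hR hC hB v.
have hw := sword_weyl L s; set w := sword s in sC hw.
have [f fI hf] := sph_weyl_roots hR hC hw.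
have [w' [_ _ ww']] := sph_weyl_inv hR hC hB hw.
have [g fg gf] : bijective f by exact: injF_bij.
(* [f (sneg (g a))] is the root opposite to [a]; passing to it changes the signs of [m] and of the
   level of [v]. *)
wlog pa : a m hm / pos_root B (g a).
  move=> wl; have /orP[/(wl a m hm) //|pa] := pos_or_neg hR hB (g a).
  have [||u [hu hv]] := wl (f (sneg (g a))) (- m); last first.
  - exists u; split=> //; apply: oppr_inj.
    by rewrite -hu -!hf (pairing_sneg hR hC hB) hf gf.
  - by rewrite fg.
  rewrite -hf (pairing_sneg hR hC hB) hf gf.
  by rewrite !(ordmod_oppr_ge0, ordmod_oppr_le0, ordmod_leN2); case: hm; [right|left].
(* As [g a] is positive, the level of [v] is nonnegative, and the second alternative collapses to
   [m = 0]. *)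
have {hm} [m0 m1] : 0 <= m /\ m <= pairing v a.
  case: hm => // -[m0 m1]; have := pairing_pos_ge0 hR hC hB sC pa; rewrite hf gf => h.
  have e : m = 0 by apply/le_anti; rewrite m0 (le_trans h).
  by rewrite e lexx h.
rewrite -[a]gf -hf in m1; have [u [hu uC vuC]] := box_level_dominant sC pa m0 m1.
exists (w' u); split; first by rewrite -[a]gf -hf ww'.
have eb b : pos_root B (g b) ->
    labs (pairing v b) = labs (pairing (w' u) b) + labs (pairing (v - w' u) b).
  have e : w (v - w' u) = w v - u by rewrite sph_weylB // ww'.
  move=> pb; rewrite -[b]gf -!hf e ww' pairingB //.
  apply: labs_between; first exact: (pairing_pos_ge0 hR hC hB uC pb).
  by rewrite -ordmod_subr_ge0 -pairingB //; exact: (pairing_pos_ge0 hR hC hB vuC pb).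
move=> b; have /orP[/eb //|pb] := pos_or_neg hR hB (g b).
have := eb (f (sneg (g b))).
by rewrite fg -!hf !(pairing_sneg hR hC hB) !hf !gf !labsN; apply.
Qed.

(** A point [x] is fixed exactly when [t] is the tensor of [a] with [<x, a^vee>]; pairing with [a]
    recovers twice this level, and 2 is invertible. *)
Lemma hyperplane_level (T : set A) a (H : set A) h x :
  hyperplane T a H -> H h -> H x <-> pairing x a = pairing h a.
Proof.
move=> [_ [t _ ->]] /=; rewrite !(reflE hC) => hh.
have {hh} -> : t = tens (root_span F a) (pairing h a).
  by apply: (addrI (h - tens (root_span F a) (pairing h a))); rewrite hh subrK.
split=> [e|->]; last by rewrite subrK.
have /addrI/(congr1 (fun z : A => pairing z a)) :=
  etrans e (esym (subrK (tens (root_span F a) (pairing x a)) x)).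
rewrite !pairing_tens // corootF_diag //.
by rewrite !scaler_nat => /(@mulr2n_inj _ _ F)/esym.
Qed.

Lemma hyperplane_meets_segment (T : set A) a (H : set A) x y :
  hyperplane T a H -> separates a H x y -> segment d x y `&` H !=set0.
Proof.
move=> hH hs.
have [h Hh hm] : exists2 h, H h &
    (pairing y a < pairing h a /\ pairing h a < pairing x a) \/
    (pairing x a < pairing h a /\ pairing h a < pairing y a).
  case: hs => -[[h Hh h1] [h' Hh' h2]]; exists h => //.
    by left; split=> //; rewrite -((hyperplane_level h' hH Hh).1 Hh').
  by right; split=> //; rewrite -((hyperplane_level h' hH Hh).1 Hh').
(* The displacement [y - x] is cut at the level of the hyperplane relative to [x]. *)
have [|u [hu hv]] := @box_level (y - x) a (pairing h a - pairing x a).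
  rewrite pairingB // !ordmod_leD2r ordmod_subr_ge0.
  rewrite -[_ - _ <= 0]ordmod_oppr_ge0 opprB ordmod_subr_ge0.
  by case: hm => -[/ltW h1 /ltW h2]; [right|left].
exists (x + u); split; last first.
  by rewrite (hyperplane_level _ hH Hh) pairingD // hu addrC subrK.
rewrite /segment /= /standard_metric -big_split; apply: eq_bigr => b _.
by rewrite /= hv opprD addrA [x + u]addrC addrK.
Qed.

End StandardMetric.

(** * Kinks of the distance functions *)

Section Kinks.
Variables (K : realType) (P : pred K) (F : subFieldType P) (n : nat).
Variables (R : {fset 'rV[K]_n}) (L : ordLmodType F) (B : {set R}).
Hypotheses (hR : root_system R) (hC : coroots_in P R) (hB : root_basis B).
Local Notation A := (model_space R L).
Local Notation C := (fund_chamber B : set A).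
Local Notation d := (@standard_metric _ _ _ _ R L B).
Local Notation qweight := (qweight F hR hC hB).
Local Notation coef := (coef F hR hC hB).
Implicit Types (a b : R) (x y z : A).

Lemma exists_nat_gt (I : finType) (f : I -> K) : (forall i, 0 <= f i) ->
  exists m : nat, forall i, f i < m.+1%:R.
Proof.
move=> h; exists (Num.bound (\sum_i f i)) => i.
have h0 : 0 <= \sum_i f i by apply: sumr_ge0.
apply: le_lt_trans (_ : \sum_i f i < _); last first.
  by apply: lt_trans (archi_boundP h0) _; rewrite ltr_nat.
by rewrite (bigD1 i) //= lerDl sumr_ge0.
Qed.

Definition proportional_coroots a b : Prop :=
  exists c : F, forall v : Fspan F R, corootF b v = c * corootF a v.

(** A hyperplane is not a finite union of proper subspaces: [v] is built by treating the roots one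
    by one and perturbing it inside the kernel of [a^vee]. *)
Lemma exists_transverse a : exists v : Fspan F R, corootF a v = 0 /\
  forall b, proportional_coroots a b \/ corootF b v != 0.
Proof.
suff [v [va hv]] : exists v : Fspan F R, corootF a v = 0 /\
    forall b, b \in enum {: R} -> proportional_coroots a b \/ corootF b v != 0.
  by exists v; split=> // b; apply: hv; rewrite mem_enum.
elim: (enum {: R}) => [|b s [v [va hv]]]; first by exists 0; rewrite corootF0.
have [hb|hb] := pselect (proportional_coroots a b).
  by exists v; split=> // g; rewrite inE => /orP[/eqP ->|/hv //]; left.
have [bv0|bv] := eqVneq (corootF b v) 0; last first.
  by exists v; split=> // g; rewrite inE => /orP[/eqP ->|/hv //]; right.
(* If [b^vee] vanished on the kernel of [a^vee], then projecting any [u] to that kernel along [a]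
   would make [b^vee] a multiple of [a^vee]. *)
have [e ea eb] : exists2 e : Fspan F R, corootF a e = 0 & corootF b e != 0.
  apply: contrapT => h; apply: hb; exists (corootF b (root_span F a) / 2) => u.
  apply/eqP; apply: contra_notT h => hu.
  have two0 : (2 : F) != 0.
    by apply/eqP => /(congr1 val)/eqP; rewrite rmorph_nat rmorph0 pnatr_eq0.
  exists (- (corootF a u / 2) *: root_span F a + u).
    by rewrite corootF_linear // corootF_diag // mulNr divfK // addNr.
  rewrite corootF_linear // mulNr addrC subr_eq0; apply: contra hu => /eqP ->.
  by rewrite mulrAC [X in X / 2]mulrC mulrAC.
(* [m + 1] exceeds every ratio of values on [e] and [v], so the roots already nonzero on [v] stay
   nonzero on the new vector. *)
have [m hm] := @exists_nat_gt R
  (fun g => `|val (corootF g e) / val (corootF g v)|) (fun=> normr_ge0 _).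
exists (m.+1%:R *: v + e); split; first by rewrite corootF_linear // va ea mulr0 addr0.
move=> g; rewrite inE => /orP[/eqP ->|/hv[|gv]]; [|by left|].
  by right; rewrite corootF_linear // bv0 mulr0 add0r.
right; rewrite corootF_linear //; apply/eqP => /(congr1 val)/eqP.
rewrite rmorphD rmorphM rmorph_nat rmorph0 /= addr_eq0 => /eqP h.
have gv' : val (corootF g v) != 0 :> K.
  by apply: contra gv => /eqP h'; apply/eqP/val_inj; rewrite h' rmorph0.
have := hm g; rewrite -normrN -mulNr -h mulfK // ger0_norm ?ler0n //.
by rewrite ltxx.
Qed.

Lemma coef_sum_gt0 a : pos_root B a -> 0 < (val (\sum_(b in B) coef a b) : K).
Proof.
move=> pa; rewrite raddf_sum lt_neqAle sumr_ge0 ?andbT => [|b bB]; last exact: pos_coef_ge0.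
apply/eqP => /esym h; apply: (@coef_neq0 _ _ F _ _ _ hR hC hB a) => b bB; apply: val_inj.
rewrite rmorph0; move/psumr_eq0P: h; apply=> // g gB; exact: pos_coef_ge0.
Qed.

(** The sum of the fundamental weights, rescaled to level 1 for [a]. *)
Lemma exists_centered a : pos_root B a ->
  exists q : Fspan F R, exists2 e : F, 0 < (val e : K) &
    corootF a q = 1 /\ forall b, b \in B -> corootF b q = e.
Proof.
move=> pa; set s := \sum_(b in B) coef a b.
have s0 : 0 < (val s : K) by exact: coef_sum_gt0.
have sn0 : s != 0 by apply: contraTneq s0 => ->; rewrite rmorph0 ltxx.
exists (s^-1 *: \sum_(b in B) qweight b), s^-1; first by rewrite fmorphV invr_gt0.
have hb b : b \in B -> corootF b (s^-1 *: \sum_(b in B) qweight b) = s^-1.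
  move=> bB; rewrite corootFZ // corootF_sum // (bigD1 b) //= big1 => [|g /andP[gB gb]].
    by rewrite corootF_qweight // eqxx addr0 mulr1.
  by rewrite corootF_qweight // eq_sym (negbTE gb).
split=> //; rewrite (corootF_coef hR hC hB).
rewrite (eq_bigr (fun b => coef a b * s^-1)) => [|b bB]; last by rewrite hb.
by rewrite -mulr_suml mulfV.
Qed.

(* A segment of points of the chamber in the hyperplane at level [1] of [a],
   crossing every other hyperplane at positive speed. *)
Lemma exists_transverse_family a (N : nat) : pos_root B a ->
  exists q r : Fspan F R, exists2 e : F, 0 < (val e : K) &
    [/\ corootF a q = 1, corootF a r = 0,
        forall b, b \in B -> corootF b q = e,
        forall b i, b \in B -> (i < N)%N ->
          (val e : K) / 2 <= val (corootF b (q + i%:R *: r)) &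
        forall b, proportional_coroots a b \/ corootF b r != 0].
Proof.
move=> pa; have [q [e e0 [qa qb]]] := exists_centered pa.
have [v [va hv]] := exists_transverse a.
(* Dividing [v] by [m + 1] keeps each of the [N] displacements below [e / 2] on every simple
   coroot. *)
have [m hm] := @exists_nat_gt R (fun b => `|val (corootF b v)| * N%:R * 2 / val e)
  (fun b => mulr_ge0 (mulr_ge0 (mulr_ge0 (normr_ge0 _) (ler0n _ _)) (ler0n _ _))
              (ltW (etrans (invr_gt0 _) e0))).
have m0 : (m.+1%:R : F) != 0.
  by apply/eqP => /(congr1 val)/eqP; rewrite rmorph_nat rmorph0 pnatr_eq0.
exists q, (m.+1%:R^-1 *: v), e => //; split=> // [|b i bB iN|b].
- by rewrite corootFZ // va mulr0.
- rewrite addrC corootF_linear // corootFZ // qb // rmorphD !rmorphM fmorphV !rmorph_nat /=.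
  set t := val (corootF b v).
  have := hm b; rewrite -/t ltr_pdivrMr // => h.
  have h1 : `|t| * i%:R <= `|t| * N%:R by rewrite ler_wpM2l // ler_nat ltnW.
  have h2 : - t * i%:R <= `|t| * i%:R by rewrite ler_wpM2r // -normrN ler_norm.
  have mp : 0 < (m.+1%:R : K) by rewrite ltr0n.
  move: (m.+1%:R) h mp => M h mp.
  have h3 : - (i%:R * (M^-1 * t)) <= val e / 2.
    rewrite -(ler_pM2r mp); have -> : - (i%:R * (M^-1 * t)) * M = - t * i%:R.
      by field; rewrite lt0r_neq0.
    by lra.
  by lra.
have [|h] := hv b; [by left|right].
by rewrite corootFZ // mulf_neq0 // invr_eq0.
Qed.

End Kinks.

(** * Detection of kinks by second differences *)

Section KinkDetection.
Variables (K : realType) (P : pred K) (F : subFieldType P) (n : nat).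
Variables (R : {fset 'rV[K]_n}) (L : ordLmodType F) (B : {set R}).
Hypotheses (hR : root_system R) (hC : coroots_in P R) (hB : root_basis B).
Local Notation A := (model_space R L).
Local Notation C := (fund_chamber B : set A).
Local Notation d := (@standard_metric _ _ _ _ R L B).
Implicit Types (a b : R) (x y z v : A).

Lemma labs_pairing_shift v (e : A) y b :
  labs (pairing (y - (v + e)) b) + labs (pairing (y - (v - e)) b) =
  labs (pairing (y - v) b + pairing e b) + labs (pairing (y - v) b - pairing e b).
Proof. by rewrite addrC !opprD !opprK !addrA -pairingD // -pairingB. Qed.

(** No root changes sign strictly inside the move from [v - e] to [v + e], so every term of the
    metric is affine there. *)
Lemma metric_flat v (e : A) y :
  (forall b, labs (pairing e b) <= labs (pairing (v - y) b)) ->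
  d (v + e) y + d (v - e) y = d v y *+ 2.
Proof.
move=> h; rewrite /standard_metric -big_split -sumrMnl; apply: eq_bigr => b _ /=.
rewrite labs_pairing_shift labs_flat //.
by apply: le_trans (h b) _; rewrite -opprB pairingN // labsN.
Qed.

(** The term of [a] contributes its full kink; the others contribute nonnegatively by convexity. *)
Lemma metric_kink v (e : A) x a : pos_root B a -> pairing (x - v) a = 0 ->
  d v x *+ 2 + labs (pairing e a) *+ 2 <= d (v + e) x + d (v - e) x.
Proof.
move=> pa h; rewrite /standard_metric -big_split -sumrMnl /=.
rewrite (eq_bigr _ (fun b _ => labs_pairing_shift v e x b)).
rewrite (bigD1 a) // [leRHS](bigD1 a) //= h labs0 mul0rn add0r [leLHS]addrC.
apply: ordmod_leD; first by rewrite add0r sub0r labsN mulr2n.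
by apply: ordmod_ler_sum => b _; exact: labs_convex.
Qed.

(** Otherwise, at a suitable point on the level of [x], the second difference of the distance to [x]
    would exceed that of the distance to [y] by at least [2k], while [lam]-closeness allows only
    [4 lam]. The threshold [M] is uniform in [x], [y] and [lam]. *)
Lemma kink_transfer a (k : L) : pos_root B a -> 0 <= k ->
  exists M : L, forall x y (lam : L), lam + lam < k ->
    (forall v, C v -> labs (d v y - d v x) <= lam) ->
    M <= pairing x a -> pairing x a - k < pairing y a.
Proof.
(* One candidate point more than there are roots, for the pigeonhole principle. *)
move=> pa k0; set N := #|{: R}|.+1.
have [q [r [e e0 [qa ra qb qrB hr]]]] := exists_transverse_family F hR hC hB N pa.
have [m hm] := @exists_nat_gt K R
  (fun b => 2 * `|val (corootF b q)| / `|val (corootF b r)|)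
  (fun b => divr_ge0 (mulr_ge0 (ler0n _ 2) (normr_ge0 _)) (normr_ge0 _)).
(* [m + 1] copies of [k] keep distinct candidates two steps [dl] apart along roots transverse to
   [a]; two copies leave room for a step [dl] inside the chamber. *)
exists (k *+ (m.+1 + 2)) => x y lam hlam hd; set c := pairing x a => hc.
have hc1 j : (j <= m.+1 + 2)%N -> k *+ j <= c.
  move=> hj; apply: le_trans hc; rewrite -(subnKC hj) mulrnDr -[leLHS]addr0.
  rewrite ordmod_leD2l; elim: (_ - _)%N => // i ih.
  by rewrite mulrS ordmod_addr_ge0.
have c0 : 0 <= c by have := hc1 0%N isT; rewrite mulr0n.
rewrite ordmod_ltNge; apply/negP => hy.
pose p (i : nat) := q + i%:R *: r.
pose v (i : nat) : A := tens (p i) c.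
pose dl : A := tens q k.
have hk : k <= c - pairing y a.
  by rewrite ordmod_leBrDr addrC -ordmod_leBrDr.
(* Some candidate has no kink of the distance to [y] strictly within one step [dl]. *)
have [i [iN hi]] : exists i, (i < N)%N /\
    forall b, labs (pairing dl b) <= labs (pairing (v i - y) b).
  apply: contrapT => hno.
  have /choice[f hf] : forall i : 'I_N, exists b,
      labs (pairing (v i - y) b) < labs (pairing dl b).
    move=> i; apply: contrapT => h; apply: hno; exists i; split=> // b.
    by rewrite ordmod_leNgt; apply/negP => hb; apply: h; exists b.
  have [i [j [ij fij]]] : exists i j : 'I_N, (i < j)%N /\ f i = f j.
    have /injectivePn[i [j ij fij]] : ~~ injectiveb f.
      apply/negP => /injectiveP /leq_card.
      by rewrite card_ord ltnn.
    move: ij; rewrite -(inj_eq val_inj) neq_ltn => /orP[h|h]; first by exists i, j.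
    by exists j, i.
  have hfi := hf i; have := hf j; rewrite -fij; move: hfi; set b := f i => hfi hfj.
  (* A root proportional to [a] never obstructs, since the levels of [y] and of the candidates
     differ by at least [k]. Any other root obstructs at most one candidate. *)
  case: (hr b) => [[t ht]|rb].
    have ep z : pairing z b = t *: pairing z a by exact: pairing_coroot_proportional.
    move: hfi; rewrite !ep !labsZ !pairingB //.
    rewrite !pairing_tens // qa scale1r corootFD // corootFZ // ra mulr0 addr0 qa scale1r.
    rewrite (labs_id k0) ordmod_ltNge => /negP; apply.
    rewrite -ordmod_subr_ge0 -scalerBr ordmod_scale_ge0 ?val_fabs //.
    by rewrite ordmod_subr_ge0; apply: le_trans hk (labs_ge _).
  have hij : labs (pairing (v j - v i) b) < labs (pairing dl b) *+ 2.
    have -> : v j - v i = (v j - y) - (v i - y) by rewrite opprB addrA subrK.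
    rewrite pairingB // mulr2n; apply: le_lt_trans (labsD _ _) _.
    by rewrite labsN; apply: ordmod_ler_ltD => //; exact: ltW.
  move: hij; rewrite ordmod_ltNge => /negP; apply.
  rewrite pairingB // !pairing_tens // -scalerBl !labsZ (labs_id k0) (labs_id c0).
  have -> : corootF b (p j) - corootF b (p i) = (j - i)%:R * corootF b r.
    rewrite /p !(corootFD hC) !(corootFZ hC) natrB; last exact: ltnW.
    by rewrite opprD addrACA subrr add0r mulrBl.
  have rb' : val (corootF b r) != 0 :> K.
    by apply: contra rb => /eqP h; apply/eqP/val_inj; rewrite h rmorph0.
  apply: (@le_trans _ _ (fabs (corootF b r) *: (k *+ m.+1))).
    rewrite -scaler_nat -[k *+ m.+1]scaler_nat !scalerA ordmod_scale_mono //.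
    rewrite !rmorphM !rmorph_nat /= !val_fabs.
    have := hm b; rewrite ltr_pdivrMr ?normr_gt0 // => /ltW h.
    by rewrite mulrC [_ * m.+1%:R]mulrC mulrC.
  apply: (@le_trans _ _ (fabs (corootF b r) *: c)).
    rewrite -ordmod_subr_ge0 -scalerBr ordmod_scale_ge0 ?val_fabs //.
    by rewrite ordmod_subr_ge0 hc1 // leq_addr.
  apply: ordmod_scale_mono => //; rewrite !val_fabs rmorphM rmorph_nat normrM /=.
  by rewrite ler_peMl // ger0_norm ?ler0n // ler1n subn_gt0.
have vE b : b \in B -> pairing (v i) b = corootF b (p i) *: c.
  by move=> bB; rewrite pairing_tens.
have hdl b : b \in B -> pairing dl b = e *: k by move=> bB; rewrite pairing_tens // qb.
have hv2 b : b \in B -> e *: k <= pairing (v i) b.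
  move=> bB; rewrite vE //; apply: (@le_trans _ _ ((e / 2) *: c)); last first.
    by apply: ordmod_scale_mono => //; rewrite rmorphM fmorphV rmorph_nat qrB.
  rewrite -scalerA ordmod_scale_le //.
  have two0 : (2 : F) != 0.
    by apply/eqP => /(congr1 val)/eqP; rewrite rmorph_nat rmorph0 pnatr_eq0.
  have two1 : 0 < (val (2 : F) : K) by rewrite rmorph_nat ltr0n.
  rewrite -(ordmod_scale_le _ _ two1) scalerA mulfV // scale1r scaler_nat.
  by rewrite hc1 // leq_addl.
have ek0 : 0 <= e *: k by rewrite ordmod_scale_ge0 // ltW.
have C0 : C (v i) by move=> b bB; apply: le_trans (hv2 b bB).
have C1 : C (v i + dl).
  by move=> b bB; rewrite pairingD // hdl // ordmod_addr_ge0 // C0.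
have C2 : C (v i - dl).
  by move=> b bB; rewrite pairingB // hdl // ordmod_subr_ge0 hv2.
(* Both second differences are compared, with an error [lam] for each of the four distances, the
   central one counted twice. *)
have key : d (v i) x *+ 2 + k *+ 2 <= d (v i) x *+ 2 + (lam + lam) *+ 2.
  apply: (@le_trans _ _ (d (v i + dl) x + d (v i - dl) x)).
    have /(metric_kink dl pa) : pairing (x - v i) a = 0.
      rewrite pairingB // pairing_tens // corootFD // corootFZ //.
      by rewrite ra mulr0 addr0 qa scale1r subrr.
    by rewrite pairing_tens // qa scale1r (labs_id k0).
  have up w : C w -> d w x <= d w y + lam.
    move=> /hd; rewrite labsB labs_le => /andP[h _].
    by rewrite addrC -ordmod_leBlDr.
  have lo w : C w -> d w y <= d w x + lam.
    move=> /hd; rewrite labs_le => /andP[h _].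
    by rewrite addrC -ordmod_leBlDr.
  apply: le_trans (ordmod_leD (up _ C1) (up _ C2)) _.
  rewrite addrACA metric_flat //.
  rewrite [(lam + lam) *+ 2]mulr2n [leRHS]addrA; apply: ordmod_leD => //.
  rewrite !mulr2n; apply: le_trans (ordmod_leD (lo _ C0) (lo _ C0)) _.
  by rewrite addrACA.
move: key; rewrite ordmod_leD2l ordmod_leNgt => /negP; apply.
by rewrite !mulr2n; apply: ordmod_ler_ltD => //; exact: ltW.
Qed.

End KinkDetection.

(** * Coarse coverings of simplices *)

Section CoarseCovering.
Variables (K : realType) (P : pred K) (F : subFieldType P) (n : nat).
Variables (R : {fset 'rV[K]_n}) (L : ordLmodType F) (B : {set R}).
Hypotheses (hR : root_system R) (hC : coroots_in P R) (hB : root_basis B).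
Local Notation A := (model_space R L).
Local Notation C := (fund_chamber B : set A).
Local Notation d := (@standard_metric _ _ _ _ R L B).
Local Notation coef := (coef F hR hC hB).
Local Notation face := (@fund_face _ _ _ _ R L B).
Implicit Types (a b : R) (x y z h : A) (I : {set R}).

Definition face_point I (l : L) : A :=
  of_coords hR hC hB (fun b => if b \in I then 0 else l).

Lemma pairing_face_point I l b : b \in B ->
  pairing (face_point I l) b = if b \in I then 0 else l.
Proof. exact: pairing_of_coords. Qed.

Lemma face_pointP I l : I \subset B -> 0 <= l -> face I (face_point I l).
Proof.
move=> /fintype.subsetP IB l0; split=> [b bB|b bI].
  by rewrite pairing_face_point //; case: ifP.
by rewrite pairing_face_point ?IB // bI.
Qed.

Lemma face0 I : face I 0.
Proof. by split=> [b _|b _]; rewrite pairing0. Qed.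

Lemma faceD I x y : face I x -> face I y -> face I (x + y).
Proof.
move=> [hx hx'] [hy hy']; split=> b hb; rewrite pairingD //.
  by rewrite ordmod_addr_ge0 ?hx ?hy.
by rewrite hx' // hy' // addr0.
Qed.

(** A point with value [l] off [I] lies in exactly the panels of type in [I]; with [L] trivial all
    faces would coincide. *)
Lemma face_type_fund_face I (l : L) : I \subset B -> 0 < l ->
  face_type B (face I) = I.
Proof.
move=> IB l0; apply/setP => b; rewrite inE; apply/andP/idP => [[bB /asboolP h]|bI].
  have [_ /(_ b)] := h _ (face_pointP IB (ltW l0)).
  rewrite finset.inE eqxx pairing_face_point // => /(_ isT).
  by case: ifP => // _ l00; rewrite l00 ltxx in l0.
split; first exact: (fintype.subsetP IB).
apply/asboolP => x [hx hx']; split=> // c; rewrite finset.inE => /eqP ->.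
exact: hx'.
Qed.

(* The roots whose coroot is positive on the relative interior of the face of
   type [I]. *)
Definition face_pos I a : bool :=
  [exists b, [&& b \in B, b \notin I & 0 < (val (coef a b) : K)]].

Lemma pairing_face_npos I a h : face I h -> ~~ face_pos I a -> pairing h a <= 0.
Proof.
move=> [hC0 hI]; rewrite negb_exists => /forallP ha.
rewrite (pairing_coef hR hC hB) -ordmod_oppr_ge0 -sumrN.
apply: ordmod_sumr_ge0 => b bB; rewrite -scaleNr.
have := ha b; rewrite bB /=; have [bI|bI /=] := boolP (b \in I).
  by rewrite hI // scaler0.
by rewrite -leNgt => h0; rewrite ordmod_scale_ge0 ?hC0 // raddfN oppr_ge0.
Qed.

Lemma pairing_face_ge0 I a h : face I h -> face_pos I a -> 0 <= pairing h a.
Proof.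
move=> [hh _] /existsP[b /and3P[bB _ hb]]; apply: (pairing_pos_ge0 hR hC hB).
  by rewrite inE.
exact: (pos_rootP bB hb).
Qed.

Lemma pairing_face_point_ge I a l : I \subset B -> 0 <= l -> face_pos I a ->
  exists2 b, 0 < (val (coef a b) : K) & coef a b *: l <= pairing (face_point I l) a.
Proof.
move=> IB l0 /existsP[b /and3P[bB bI hb]]; exists b => //.
have pa := pos_rootP bB hb.
rewrite (pairing_coef hR hC hB) (bigD1 b) //= pairing_face_point // (negbTE bI).
rewrite -[leLHS]addr0 ordmod_leD2l; apply: ordmod_sumr_ge0 => g /andP[gB _].
rewrite ordmod_scale_ge0 ?pos_coef_ge0 //.
by have [] := face_pointP IB l0; move=> /(_ g gB).
Qed.

Lemma deep_face_point I (M : L) : I \subset B ->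
  exists f, face I f /\ forall a, face_pos I a -> M <= pairing f a.
Proof.
(* One [l] serves all finitely many coefficients; inverses of zero coefficients are 0 and
   harmless. *)
move=> IB; have [l [l0 hl]] := ordmod_fin_max (fun p : R * R => (coef p.1 p.2)^-1 *: M).
exists (face_point I l); split; first exact: face_pointP.
move=> a /(pairing_face_point_ge IB l0)[b hb]; apply: le_trans.
have hb0 : coef a b != 0 by apply: contraTneq hb => ->; rewrite rmorph0 ltxx.
rewrite -[leLHS]scale1r -(mulfV hb0) -scalerA ordmod_scale_le //.
exact: (hl (a, b)).
Qed.

Lemma pairing_face_relint I a h : face I h ->
  (forall b, b \in B -> b \notin I -> 0 < pairing h b) ->
  (0 < pairing h a) = face_pos I a.
Proof.
move=> hI hpos; apply/idP/idP => [|/[dup] ha /existsP[b /and3P[bB bI hb]]].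
  by apply: contraTT => ha; rewrite -ordmod_leNgt (pairing_face_npos hI).
have pa := pos_rootP bB hb.
rewrite (pairing_coef hR hC hB) (bigD1 b) //= -[ltLHS]addr0 addrC.
apply: ordmod_ler_ltD; last by rewrite ordmod_scale_gt0 // hpos.
apply: ordmod_sumr_ge0 => g /andP[gB _].
by rewrite ordmod_scale_ge0 ?pos_coef_ge0 //; case: hI => /(_ g gB).
Qed.

(** The inversions of [- w (w1 h)] are the positive roots positive on [w (w1 h)], and likewise for
    [w2]; the two points share an orbit, so [inversions_inj] identifies them. *)
Lemma eq_on_relint I w w1 w2 h (f1 f2 fw : R -> R) :
  sph_weyl w -> sph_weyl w1 -> sph_weyl w2 ->
  (forall x a, pairing (w x) a = pairing x (fw a)) ->
  (forall x a, pairing (w1 x) a = pairing x (f1 a)) ->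
  (forall x a, pairing (w2 x) a = pairing x (f2 a)) ->
  (forall a, pos_root B a -> face_pos I (f1 (fw a)) = face_pos I (f2 (fw a))) ->
  face I h -> (forall b, b \in B -> b \notin I -> 0 < pairing h b) ->
  w1 h = w2 h.
Proof.
move=> hw hw1 hw2 ew e1 e2 hf hI hpos.
have [w' [hw' ww' w'w]] := sph_weyl_inv hR hC hB hw.
have [w1' [hw1' ww1 _]] := sph_weyl_inv hR hC hB hw1.
pose u := w \o (w2 \o (w1' \o w')).
have hu : sph_weyl u by do 3 apply: sph_weyl_comp => //.
have uE : u (- w (w1 h)) = - w (w2 h).
  rewrite /u /= (sph_weylN hC _ hw') (sph_weylN hC _ hw1') (sph_weylN hC _ hw2).
  by rewrite (sph_weylN hC _ hw) ww' ww1.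
apply: (can_inj ww'); apply: oppr_inj; rewrite -uE.
apply/esym/(inversions_inj hR hC hB hu); rewrite uE.
apply/setP => a; rewrite !finset.inE; have [pa|//] := boolP (pos_root B a).
rewrite /= !pairingN // !ordmod_oppr_lt0 !ew e1 e2.
by rewrite !(pairing_face_relint _ hI hpos) hf.
Qed.

Definition affine_face I (w : A -> A) x : set A := [set w h + x | h in face I].

Lemma coarsely_covered_eq I w w1 w2 t x1 x2 (e lam : L) : I \subset B -> 0 < e ->
  sph_weyl w -> sph_weyl w1 -> sph_weyl w2 ->
  coarsely_covered d [set w v + t | v in C] (affine_face I w1 x1) (affine_face I w2 x2) lam ->
  forall h, face I h -> w1 h = w2 h.
Proof.
move=> IB e0 hw hw1 hw2 hcov.
have [w' [hw' ww' w'w]] := sph_weyl_inv hR hC hB hw.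
have [fw _ ew] := sph_weyl_roots hR hC hw'.
have [f1 _ e1] := sph_weyl_roots hR hC hw1.
have [f2 _ e2] := sph_weyl_roots hR hC hw2.
(* Nonnegative and strictly above [2 lam], whatever the sign of [lam]. *)
pose k := labs lam + labs lam + e.
have k0 : 0 <= k by rewrite !ordmod_addr_ge0 ?labs_ge0 // ltW.
have hk : lam + lam < k.
  rewrite -[ltLHS]addr0; apply: ordmod_ler_ltD => //.
  by apply: ordmod_leD; exact: labs_ge.
have /choice[Mf hMf] : forall a, exists M : L, pos_root B a ->
    forall x y, (forall v, C v -> labs (d v y - d v x) <= lam) ->
    M <= pairing x a -> pairing x a - k < pairing y a.
  move=> a; have [pa|] := boolP (pos_root B a); last by exists 0.
  have [M hM] := kink_transfer hR hC hB pa k0; exists M => _ x y hd.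
  exact: hM hk hd.
have [M [M0 hM]] := ordmod_fin_max Mf.
have [N1 [N10 hN1]] := ordmod_fin_max (fun a => labs (pairing (x1 - t) a)).
have [N2 [N20 hN2]] := ordmod_fin_max (fun a => labs (pairing (x2 - t) a)).
pose N := N1 + N2.
have N0 : 0 <= N by rewrite ordmod_addr_ge0.
have hN i a : labs (pairing ((if i then x1 else x2) - t) a) <= N.
  case: i.
    by apply: le_trans (hN1 a) _; rewrite -[leLHS]addr0 ordmod_leD2l.
  by apply: le_trans (hN2 a) _; rewrite -[leLHS]add0r ordmod_leD2r.
(* Deep enough to leave a gap: beyond [f], roots in [face_pos] reach at least [M + k + N], the
   others at most [N], so a loss below [k] cannot turn the first kind into the second. *)
have [f [fI hf]] := deep_face_point (M + k + N + N) IB.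
have hlow h i a : face I h -> ~~ face_pos I a -> forall a',
    pairing h a + pairing ((if i then x1 else x2) - t) a' <= N.
  move=> hh ha a'; rewrite -[leRHS]add0r ordmod_leD ?(pairing_face_npos hh ha) //.
  exact: le_trans (labs_ge _) (hN i a').
have hhigh h i a : face I h -> face_pos I a -> forall a',
    M + k + N <= pairing (f + h) a + pairing ((if i then x1 else x2) - t) a'.
  move=> hh ha a'; rewrite -[leLHS](addrK N) ordmod_leD //.
    by rewrite pairingD // -[leLHS]addr0 ordmod_leD ?hf ?(pairing_face_ge0 hh ha).
  by rewrite -ordmod_leN2 opprK; apply: le_trans (labs_geN _) (hN i a').
(* The booleans select [x1] or [x2], so that one argument serves both inclusions; [a'] is the root
   evaluated on the translation part. *)
have step (i j : bool) a h h' a1 a2 a' x y : pos_root B a -> face I h -> face I h' ->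
    pairing x a = pairing (f + h) a1 + pairing ((if i then x1 else x2) - t) a' ->
    pairing y a = pairing (f + h') a2 + pairing ((if j then x1 else x2) - t) a' ->
    (forall v, C v -> labs (d v y - d v x) <= lam) ->
    face_pos I a1 -> face_pos I a2.
  move=> pa hh hh' ex ey hd ha1; apply: contraT => ha2.
  have hx := hhigh h i a1 hh ha1 a'; rewrite -ex in hx.
  have hx' : Mf a <= pairing x a.
    apply: le_trans hx; rewrite -addrA -[leLHS]addr0; apply: ordmod_leD => //.
    by rewrite ordmod_addr_ge0.
  have := hMf a pa x y hd hx'; rewrite ordmod_ltBlDr ordmod_ltNge => /negP; case.
  apply: le_trans hx; rewrite [leRHS]addrAC ordmod_leD2r ey.
  apply: le_trans (hlow _ j _ (faceD fI hh') ha2 a') _.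
  by rewrite -[leLHS]add0r ordmod_leD2r.
have sub1 : sub_face [set z + w1 f | z in affine_face I w1 x1] (affine_face I w1 x1).
  split; first by exists (w1 f).
  move=> _ [_ [h hh <-] <-]; exists (h + f); first exact: faceD.
  by rewrite sph_weylD // addrAC.
have [X2' [[a2 ->] sub2] hX2] := hcov _ sub1.
(* The apex of the sub-face lies in the second simplex, so its translation vector is the image of a
   point of the face. *)
have [h2 hh2 eh2] : affine_face I w2 x2 (w2 0 + x2 + a2).
  by apply: sub2; exists (w2 0 + x2) => //; exists 0 => //; exact: face0.
have a2E : a2 = w2 h2.
  by apply: (addIr x2); rewrite eh2 sph_weyl0 // add0r addrC.
(* The tested point is also pushed by [f], so that both it and its partner are deep. *)
have [|x [_ [h1 hh1 <-] xE] hd] := hX2 (w2 f + x2 + a2).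
  by exists (w2 f + x2) => //; exists f.
(* The isometry carrying [C] to the given chamber is undone, as [kink_transfer] speaks of [C]. *)
have hd' v : C v -> labs (d v (w' (w2 f + x2 + a2 - t)) - d v (w' (x - t))) <= lam.
  move=> Cv; have := hd (w v + t) (ex_intro2 _ _ v Cv erefl).
  have dE y : d (w v + t) y = d v (w' (y - t)).
    by rewrite -[y in LHS](subrK t) standard_metric_translation -{1}[y - t]w'w;
      exact: standard_metric_sph_weyl.
  by rewrite !dE.
have xP a : pairing (w' (x - t)) a =
    pairing (f + h1) (f1 (fw a)) + pairing (x1 - t) (fw a).
  rewrite ew -e1 -pairingD // -xE (sph_weylD hC _ _ hw1); congr pairing.
  by rewrite -!addrA [RHS]addrCA [x1 + (_ + _)]addrCA.
have yP a : pairing (w' (w2 f + x2 + a2 - t)) a =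
    pairing (f + h2) (f2 (fw a)) + pairing (x2 - t) (fw a).
  rewrite ew a2E -e2 -pairingD // (sph_weylD hC _ _ hw2); congr pairing.
  by rewrite -!addrA [x2 + (_ + _)]addrCA.
have hface a : pos_root B a -> face_pos I (f1 (fw a)) = face_pos I (f2 (fw a)).
  move=> pa; apply/idP/idP.
    exact: (step true false a h1 h2 _ _ _ _ _ pa hh1 hh2 (xP a) (yP a) hd').
  apply: (step false true a h2 h1 _ _ _ _ _ pa hh2 hh1 (yP a) (xP a)) => v Cv.
  by rewrite labsB; exact: hd'.
have relint h : face I h -> (forall b, b \in B -> b \notin I -> 0 < pairing h b) ->
    w1 h = w2 h.
  exact: eq_on_relint hw' hw1 hw2 ew e1 e2 hface.
(* A boundary point becomes interior on adding an interior point, which then cancels by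
   linearity. *)
move=> h hh; have pI := face_pointP IB (ltW e0).
have pE b : b \in B -> b \notin I -> 0 < pairing (face_point I e) b.
  by move=> bB bI; rewrite pairing_face_point // (negbTE bI).
apply: (addIr (w1 (face_point I e))); rewrite {2}(relint _ pI pE).
rewrite -!sph_weylD //; apply: relint; first exact: faceD.
move=> b bB bI; rewrite pairingD // -[ltLHS]addr0; apply: ordmod_ler_ltD; last exact: pE.
by case: hh => /(_ b bB).
Qed.

Lemma coarsely_covered_translate (S X1 X2 : set A) (J : {set R}) (lam : L) :
  weyl_chamber B S -> weyl_simplex_of_type B J X1 -> weyl_simplex_of_type B J X2 ->
  coarsely_covered d S X1 X2 lam -> translate X1 X2.
Proof.
move=> [g [w [t [hw _ hg]]] ->].
move=> [_ [g1 [[I1 I1B ->] [w1 [x1 [hw1 _ hg1]]] -> ->]]].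
move=> [_ [g2 [[I2 I2B ->] [w2 [x2 [hw2 _ hg2]]] -> eJ]]] hcov.
have gE : g = fun v => w v + t by apply/funext.
have g1E : g1 = fun v => w1 v + x1 by apply/funext.
have g2E : g2 = fun v => w2 v + x2 by apply/funext.
move: hcov; rewrite gE g1E g2E {g g1 g2 gE g1E g2E hg hg1 hg2} => hcov.
(* Without positive elements [L] is trivial and the model space is one point; faces then no longer
   determine their types. *)
have [[e e0]|no] := pselect (exists e : L, 0 < e); last first.
  have L0 (l : L) : l = 0.
    apply/le_anti; rewrite !ordmod_leNgt; apply/andP; split; apply/negP => h; apply: no.
      by exists l.
    by exists (- l); rewrite ordmod_oppr_gt0.
  have A0 (x : A) : x = 0.
    by apply: (pairing_ext hR hC hB) => b _; rewrite [LHS]L0 [RHS]L0.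
  exists 0; apply/seteqP; split=> x _; rewrite [x]A0.
    exists (w1 0 + x1); last by rewrite [LHS]A0.
    by exists 0 => //; exact: face0.
  by exists 0; rewrite ?[LHS]A0 //; exact: face0.
move: eJ; rewrite !(face_type_fund_face _ e0) // => eI; subst I2.
have eqw := coarsely_covered_eq I1B e0 hw hw1 hw2 hcov.
exists (x2 - x1); apply/seteqP; split=> x.
  move=> [h hh <-]; exists (w1 h + x1); first by exists h.
  by rewrite eqw // [x2 - x1]addrC addrA addrK.
move=> [_ [h hh <-] <-]; exists h => //.
by rewrite eqw // [x2 - x1]addrC addrA addrK.
Qed.

End CoarseCovering.

Theorem lemma10p1 (K : realType) (P : pred K) (F : subFieldType P) (n : nat)
    (R : {fset 'rV[K]_n}) (L : ordLmodType F) (B : {set R})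
    (T : set (model_space R L)) :
  root_system R -> coroots_in P R -> root_basis B -> translation_group T ->
  weyl_compatible B T (standard_metric B).
Proof.
move=> hR hC hB _; split.
- exact: standard_metric_is_metric.
- by move=> g hg x y; exact: (affine_weyl_isometry hR hC hB _ _ hg).
- move=> S X1 X2 J hS h1 h2 [lam hcov].
  exact: (coarsely_covered_translate hR hC hB hS h1 h2 hcov).
- by move=> a H x y hH hs; exact: (hyperplane_meets_segment hR hC hB hH hs).
Qed.
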